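(* Let $\mathcal H$ be a separable complex Hilbert space and let $w\colon\mathbb N_0\to\mathbb R_{>0}$ satisfy $w(0)=1$, $w^{-1}\in\ell^2(\mathbb N_0)$, and $w^{-2}*w^{-2}\le C\,w^{-2}$ for some constant $C$. Let $F_w(\mathcal H)$ be the weighted symmetric Fock space, a commutative unital Banach algebra under the symmetric tensor product $\vee$, with spectrum $\sigma(F_w(\mathcal H))$. Then the Gelfand map $\Gamma\colon F_w(\mathcal H)\to C(\sigma(F_w(\mathcal H)))$, $(\Gamma f)(\chi)=\chi f$, is injective. As a result, the space $\hat F_w(\mathcal H):=\Gamma(F_w(\mathcal H))$, equipped with the inner product $\langle\hat f,\hat g\rangle_{\hat F_w(\mathcal H)}=\langle\Gamma^{-1}\hat f,\Gamma^{-1}\hat g\rangle_{F_w(\mathcal H)}$, is a unital reproducing kernel Hilbert algebra with reproducing kernel $\hat k\colon\sigma(F_w(\mathcal H))\times\sigma(F_w(\mathcal H))\to\mathbb C$, $$\hat k(\chi_1,\chi_2)=\langle\xi_1,\xi_2\rangle_{F_w(\mathcal H)},\qquad \chi_i=\langle\xi_i,\cdot\rangle_{F_w(\mathcal H)}.$$ Moreover, $F_w(\mathcal H)$ and $\hat F_w(\mathcal H)$ are isomorphic Banach algebras under the Gelfand map.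
   Context: Inner products are conjugate-linear in the first argument. The symmetric tensor product is $f_1\vee\cdots\vee f_n=\frac1{n!}\sum_{s\in S_n}f_{s(1)}\otimes\cdots\otimes f_{s(n)}$, and $\mathcal H^{\vee n}\subseteq\mathcal H^{\otimes n}$ is the closed subspace of symmetric tensors. $F_w(\mathcal H)$ is the Hilbert space completion of $\mathbb C\oplus\mathcal H\oplus\mathcal H^{\vee2}\oplus\cdots$ for the inner product in which different degrees are orthogonal, $\langle a,b\rangle=\bar ab$ on $\mathbb C$, and which on $\mathcal H^{\vee n}$ equals $w^2(n)$ times the inner product of $\mathcal H^{\otimes n}$. Under the hypotheses on $w$ it is a unital commutative Banach algebra under $\vee$, with unit $\Omega=1\in\mathbb C$, for an operator norm equivalent to the Hilbert space norm. Its spectrum $\sigma(F_w(\mathcal H))$ is the set of nonzero multiplicative linear functionals, with the weak-$^*$ topology; these are bounded, so each has a unique representing vector $\xi\in F_w(\mathcal H)$ with $\chi=\langle\xi,\cdot\rangle$. A reproducing kernel Hilbert space $\mathcal G$ of functions on a set $Y$ has, for each $y\in Y$, a vector $k_y\in\mathcal G$ with $f(y)=\langle k_y,f\rangle_{\mathcal G}$ for all $f\in\mathcal G$, and reproducing kernel $k(y,y')=\langle k_y,k_{y'}\rangle_{\mathcal G}$. It is a reproducing kernel Hilbert algebra (RKHA) if $k_y\mapsto k_y\otimes k_y$, $y\in Y$, extends to a bounded linear map $\mathcal G\to\mathcal G\otimes\mathcal G$ (Hilbert space tensor product). It is then an algebra under pointwise multiplication, and a Banach algebra for the operator norm of multiplication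 operators; it is unital if it contains the constant function $1$. Banach algebra isomorphism means algebra isomorphism that is bounded with bounded inverse. *)

(* Defs.v *)
From HB Require Import structures.
From mathcomp Require Import all_boot all_order all_algebra all_fingroup.
From mathcomp Require Import complex.
From mathcomp Require Import all_classical reals topology normedtype sequences.

Set Implicit Arguments.
Unset Strict Implicit.
Unset Printing Implicit Defensive.

Import Order.TTheory GRing.Theory Num.Theory.
Import numFieldNormedType.Exports.

Local Open Scope classical_set_scope.
Local Open Scope complex_scope.
Local Open Scope ring_scope.

(* The norm of a module over R[i] is R[i]-valued (with values of the form
   a%:C, 0 <= a); completeness is part of CompleteNormedModule.  Linearity in
   the first argument up to conjugation follows from hdotC. *)
HB.mixin Record CompleteNormedModule_isHilbert (R : realType) (H : Type)
    of CompleteNormedModule R[i] H := {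
  hdot : H -> H -> R[i];
  hdotPr : forall (a : R[i]) (x y z : H),
    hdot x (a *: y + z) = a * hdot x y + hdot x z;
  hdotC : forall x y : H, hdot x y = (hdot y x)^*;
  hdot_norm : forall x : H, hdot x x = `|x| ^+ 2
}.

#[short(type="hilbertType")]
HB.structure Definition Hilbert (R : realType) :=
  { H of CompleteNormedModule_isHilbert R H & CompleteNormedModule R[i] H }.

Definition separable_space (T : topologicalType) : Prop :=
  exists A : set T, countable A /\ dense A.

Definition lin_span (K : pzRingType) (V : lmodType K) (A : set V) : set V :=
  [set v | exists (n : nat) (c : 'I_n -> K) (a : 'I_n -> V),
     (forall i, A (a i)) /\ v = \sum_(i < n) c i *: a i].

Definition bounded_map (K : numFieldType) (V W : normedModType K)
    (f : V -> W) : Prop :=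
  exists M : K, forall x, `|f x| <= M * `|x|.

Definition bounded_map2 (K : numFieldType) (U V W : normedModType K)
    (f : U -> V -> W) : Prop :=
  exists M : K, forall x y, `|f x y| <= M * `|x| * `|y|.

Definition bilinear_map (K : pzRingType) (U V W : lmodType K)
    (f : U -> V -> W) : Prop :=
  (forall y, linear (f^~ y)) /\ (forall x, linear (f x)).

Section HilbertTensor.
Variable R : realType.

(* The Hilbert space tensor product G1 (x) G2: the completion of the algebraic
   tensor product for <x1 (x) x2, y1 (x) y2> = <x1, y1> <x2, y2>.  The fields
   determine it up to a unique unitary compatible with [htens]. *)
Structure htensor (G1 G2 : hilbertType R) := HTensor {
  htensor_sort :> hilbertType R;
  htens : G1 -> G2 -> htensor_sort;
  htens_bilinear : bilinear_map htens;
  htens_dot : forall x1 y1 x2 y2,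
    hdot (htens x1 x2) (htens y1 y2) = hdot x1 y1 * hdot x2 y2;
  htens_dense :
    closure (lin_span [set t | exists x1 x2, t = htens x1 x2]) = setT
}.

Definition multilinear_map (H V : lmodType R[i]) (n : nat)
    (f : ('I_n -> H) -> V) : Prop :=
  forall (i : 'I_n) (a : R[i]) (x y z : 'I_n -> H),
    (forall j, j != i -> x j = z j /\ y j = z j) ->
    z i = a *: x i + y i -> f z = a *: f x + f y.

(* The n-th Hilbert space tensor power of H, in the same sense; its elementary
   tensors are [hptens x] = x 0 (x) ... (x) x (n-1).  For n = 0 it is the line
   spanned by the unit vector [hptens] of the empty family, i.e. R[i]. *)
Structure htpower (H : hilbertType R) (n : nat) := HTPower {
  htpower_sort :> hilbertType R;
  hptens : ('I_n -> H) -> htpower_sort;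
  hptens_multilinear : multilinear_map hptens;
  hptens_dot : forall x y,
    hdot (hptens x) (hptens y) = \prod_(i < n) hdot (x i) (y i);
  hptens_dense : closure (lin_span (range hptens)) = setT
}.

End HilbertTensor.

Section Fock.
Variables (R : realType) (H : hilbertType R) (P : forall n, htpower H n).

(* x 0 \/ ... \/ x (n-1) *)
Definition sym_tens (n : nat) (x : 'I_n -> H) : P n :=
  (n`!%:R : R[i])^-1 *: \sum_(s : 'S_n) hptens (P n) (fun i => x (s i)).

Definition sym_power (n : nat) : set (P n) :=
  closure (lin_span (range (@sym_tens n))).

(* The Hilbert space completion of the direct sum of the symmetric powers, with
   the n-th summand rescaled by (w n)^2.  [fock_inj n] is the inclusion of the
   n-th summand; its values outside [sym_power n] are irrelevant.  Up to a
   unique unitary compatible with the inclusions there is one such space. *)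
Structure fock_space (w : nat -> R) := FockSpace {
  fock_sort :> hilbertType R;
  fock_inj : forall n, P n -> fock_sort;
  fock_inj_linear : forall n (a : R[i]) (s t : P n),
    sym_power s -> sym_power t ->
    fock_inj (a *: s + t) = a *: fock_inj s + fock_inj t;
  fock_dot : forall n (s t : P n), sym_power s -> sym_power t ->
    hdot (fock_inj s) (fock_inj t) = ((w n) ^+ 2)%:C * hdot s t;
  fock_orth : forall n m (s : P n) (t : P m), n != m ->
    sym_power s -> sym_power t -> hdot (fock_inj s) (fock_inj t) = 0;
  fock_dense : closure (lin_span
    [set f | exists n (s : P n), sym_power s /\ f = fock_inj s]) = setT
}.

Definition ord_cat (n m : nat) (x : 'I_n -> H) (y : 'I_m -> H)
    (k : 'I_(n + m)) : H :=
  match fintype.split k with inl i => x i | inr j => y j end.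

Definition fock_unit (w : nat -> R) (F : fock_space w) : F :=
  fock_inj F (sym_tens (fun i : 'I_0 => 0)).

(* The symmetric tensor product on the completion: the bounded bilinear
   extension of (x1\/...\/xn) \/ (y1\/...\/ym) = x1\/...\/xn\/y1\/...\/ym. *)
Definition is_vee (w : nat -> R) (F : fock_space w) (vee : F -> F -> F) : Prop :=
  [/\ bilinear_map vee, bounded_map2 vee &
      forall n m (x : 'I_n -> H) (y : 'I_m -> H),
        vee (fock_inj F (sym_tens x)) (fock_inj F (sym_tens y)) =
        fock_inj F (sym_tens (ord_cat x y))].

End Fock.

Section BanachAlgebra.
Variable R : realType.

(* N is a complete submultiplicative norm for the associative product mul. *)
Record banach_algebra (V : lmodType R[i]) (mul : V -> V -> V) (N : V -> R)
    : Prop := BanachAlgebra {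
  ba_bilinear : bilinear_map mul;
  ba_assoc : associative mul;
  ba_norm_eq0 : forall f, N f = 0 -> f = 0;
  ba_norm_triangle : forall f g, N (f + g) <= N f + N g;
  ba_norm_homog : forall (a : R[i]) f, (N (a *: f))%:C = `|a| * (N f)%:C;
  ba_norm_mul : forall f g, N (mul f g) <= N f * N g;
  ba_complete : forall u : nat -> V,
    (forall e, 0 < e -> exists n0, forall m n, (n0 <= m)%N -> (n0 <= n)%N ->
       N (u m - u n) < e) ->
    exists l, forall e, 0 < e -> exists n0, forall n, (n0 <= n)%N ->
       N (u n - l) < e
}.

Definition banach_algebra_iso (V W : lmodType R[i])
    (mulV : V -> V -> V) (NV : V -> R) (mulW : W -> W -> W) (NW : W -> R)
    (phi : V -> W) : Prop :=
  [/\ linear phi, {morph phi : f g / mulV f g >-> mulW f g}, bijective phi,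
      (exists M, forall f, NW (phi f) <= M * NV f) &
      (exists M, forall f, NV f <= M * NW (phi f))].

(* The norm of the operator g |-> mul f g.  The supremum is meaningful when
   that operator is bounded. *)
Definition op_norm (V : normedModType R[i]) (mul : V -> V -> V) (f : V) : R :=
  sup [set complex.Re `|mul f g| | g in [set g | `|g| <= 1]].

End BanachAlgebra.

Section Spectrum.
Variables (R : realType) (V : lmodType R[i]) (mul : V -> V -> V).

Definition is_character (chi : V -> R[i]) : Prop :=
  [/\ forall (a : R[i]) f g, chi (a *: f + g) = a * chi f + chi g,
      forall f g, chi (mul f g) = chi f * chi g &
      exists f, chi f != 0].

Definition character := {classic {chi : V -> R[i] | is_character chi}}.

Definition char_val (chi : character) : V -> R[i] :=
  sval (chi : {chi : V -> R[i] | is_character chi}).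

(* The spectrum, with the weak-* topology (pointwise convergence on V). *)
Definition spectrum : topologicalType :=
  initial_topology (char_val : character -> {ptws V -> R[i]^o}).

Definition gelfand (f : V) : spectrum -> R[i]^o := fun chi => char_val chi f.

End Spectrum.

Section FunctionSpaces.
Variable R : realType.

(* A Hilbert space whose vectors are functions on Y; [hfun] sends a vector to
   the function it is. *)
Structure hfunspace (Y : Type) := HFunSpace {
  hfun_sort :> hilbertType R;
  hfun : hfun_sort -> Y -> R[i];
  hfun_linear : forall (a : R[i]) f g y,
    hfun (a *: f + g) y = a * hfun f y + hfun g y;
  hfun_inj : injective hfun
}.

Variables (Y : Type) (G : hfunspace Y).

Definition kernel_sections (k : Y -> G) : Prop :=
  forall y f, hfun f y = hdot (k y) f.

Definition is_reproducing_kernel (kappa : Y -> Y -> R[i]) : Prop :=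
  exists k : Y -> G, kernel_sections k /\
    forall y y', kappa y y' = hdot (k y) (k y').

(* The tensor product is unique up to unitaries, so quantifying over its
   realizations is the same as fixing one. *)
Definition is_rkha : Prop :=
  exists k : Y -> G, kernel_sections k /\
    forall T : htensor G G, exists Delta : G -> T,
      [/\ linear Delta, bounded_map Delta &
          forall y, Delta (k y) = htens T (k y) (k y)].

Definition hfun_unital : Prop := exists u : G, forall y, hfun u y = 1.

Definition is_pointwise_mul (mul : G -> G -> G) : Prop :=
  forall f g y, hfun (mul f g) y = hfun f y * hfun g y.

End FunctionSpaces.

(* Main.v *)
Require Import Defs.
From HB Require Import structures.
From mathcomp Require Import all_boot all_order all_algebra all_fingroup zify.
From mathcomp Require Import complex ring lra.
From mathcomp Require Import all_classical reals topology normedtype sequences.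

Set Implicit Arguments.
Unset Strict Implicit.
Unset Printing Implicit Defensive.

Import Order.TTheory GRing.Theory Num.Theory.
Import numFieldNormedType.Exports.

Local Open Scope classical_set_scope.
Local Open Scope complex_scope.
Local Open Scope ring_scope.

(** The vectors e_n(x) = x1 \/ ... \/ xn of F_w(H) are total, and by Glynn's
    permanent formula so are the rescaled powers eta_n(h) = w(n)^-2 h^(\/ n).
    The adjoint of the multiplication must send eta_n(h) to
    sum_(k <= n) eta_k(h) (x) eta_(n-k)(h); since eta_n(h) has Gram kernel
    delta_nm w(n)^-2 <h,h'>^n, the Gram kernel of these images is
    delta_nm (w^-2 * w^-2)(n) <h,h'>^n, so w^-2 * w^-2 <= C w^-2 makes the adjoint
    bounded by sqrt C.  This gives the product and the RKHA property at once.
    As w^-1 is square summable, for |h| <= 1 the functional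
    e_n(x) |-> <h,x1> ... <h,xn> is bounded, hence a character; restricting it to
    the ray t h gives a power series in t with coefficients <eta_n(h), f>, so an f
    killed by all these characters is 0. *)

(** * Real-valued norms and inner products *)

(** The Fock space and the tensor product are known only through dense spanning families with
    prescribed inner products. Every new vector (a product, a coherent vector, a value of the
    comultiplication) is therefore produced by [riesz_family]: its pairings with a family are
    prescribed, and the resulting functional is bounded on finite combinations. Equality of vectors
    is tested on a total family. Powers are preferred to general elementary tensors because neither
    their Gram kernel nor their coproduct involves a sum over permutations or subsets. The product
    is built before any Hilbert space F (x) F is at hand, so its bound rests on a Cauchy-Schwarz
    inequality for finite formal tensors. The two Gram kernels can be compared because their
    difference, with weights C w^-2 - w^-2 * w^-2 >= 0, is a Gram kernel too. Characters are defined
    purely algebraically; their boundedness, without which they have no representing vector, has to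
    be derived from completeness. *)

Definition rnorm (R : realType) (V : normedModType R[i]) (x : V) : R :=
  complex.Re `|x|.

(** Like [rnorm], a copy with values in [R]: the order of [R[i]] is only partial, and the estimates
    need a real field. *)
Definition cabs (R : realType) (z : R[i]) : R := complex.Re `|z|.

Section RealNorm.
Variable R : realType.
Implicit Types (V : normedModType R[i]) (z : R[i]).

Lemma ge0_ReE z : 0 <= z -> z = (complex.Re z)%:C.
Proof. by case: z => a b; rewrite lecE /= => /andP[/eqP-> _]. Qed.

Lemma normE V (x : V) : `|x| = (rnorm x)%:C.
Proof. exact/ge0_ReE/normr_ge0. Qed.

Lemma cabsE z : `|z| = (cabs z)%:C.
Proof. exact/ge0_ReE/normr_ge0. Qed.

Lemma rnorm_ge0 V (x : V) : 0 <= rnorm x.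
Proof. by rewrite -lecR -normE normr_ge0. Qed.

Lemma cabs_ge0 z : 0 <= cabs z.
Proof. by rewrite -lecR -cabsE normr_ge0. Qed.

Lemma rnorm0_eq0 V (x : V) : rnorm x = 0 -> x = 0.
Proof. by move=> x0; apply/eqP; rewrite -normr_eq0 normE x0. Qed.

Lemma rnorm0 V : rnorm (0 : V) = 0.
Proof. by rewrite /rnorm normr0. Qed.

Lemma rnormD V (x y : V) : rnorm (x + y) <= rnorm x + rnorm y.
Proof. by rewrite -lecR rmorphD /= -!normE ler_normD. Qed.

Lemma rnormN V (x : V) : rnorm (- x) = rnorm x.
Proof. by rewrite /rnorm normrN. Qed.

Lemma rnorm_distC V (x y : V) : rnorm (x - y) = rnorm (y - x).
Proof. by rewrite /rnorm distrC. Qed.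

Lemma rnormZ V a (x : V) : rnorm (a *: x) = cabs a * rnorm x.
Proof. by apply: complexI; rewrite rmorphM /= -!normE -cabsE normrZ. Qed.

Lemma rnorm_triangle V (x y z : V) : rnorm (x - z) <= rnorm (x - y) + rnorm (y - z).
Proof. by rewrite (_ : x - z = (x - y) + (y - z)) ?rnormD // addrA subrK. Qed.

Lemma cabs0_eq0 z : cabs z = 0 -> z = 0.
Proof. by move=> x0; apply/eqP; rewrite -normr_eq0 cabsE x0. Qed.

Lemma cabs0 : cabs (0 : R[i]) = 0.
Proof. by rewrite /cabs normr0. Qed.

Lemma cabs1 : cabs (1 : R[i]) = 1.
Proof. by rewrite /cabs normr1. Qed.

Lemma cabsM y z : cabs (y * z) = cabs y * cabs z.
Proof. by apply: complexI; rewrite rmorphM /= -!cabsE normrM. Qed.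

Lemma cabsN z : cabs (- z) = cabs z.
Proof. by rewrite /cabs normrN. Qed.

Lemma cabsD y z : cabs (y + z) <= cabs y + cabs z.
Proof. by rewrite -lecR rmorphD /= -!cabsE ler_normD. Qed.

Lemma cabsV z : cabs z^-1 = (cabs z)^-1.
Proof. by apply: complexI; rewrite fmorphV /= -!cabsE normfV. Qed.

Lemma cabs_conj z : cabs z^* = cabs z.
Proof. by rewrite /cabs norm_conjC. Qed.

Lemma cabs_real (a : R) : cabs a%:C = `|a|.
Proof. by rewrite /cabs normc_def /= expr0n addr0 sqrtr_sqr. Qed.

Lemma cabs_ger0 (a : R) : 0 <= a -> cabs a%:C = a.
Proof. by move=> a0; rewrite cabs_real ger0_norm. Qed.

Lemma Re_le_cabs z : complex.Re z <= cabs z.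
Proof. by apply: le_trans (ler_norm _) _; rewrite -lecR -cabsE normc_ge_Re. Qed.

Lemma mul_conj_cabs z : z * z^* = (cabs z ^+ 2)%:C.
Proof. by rewrite -normCK cabsE rmorphXn. Qed.

Lemma conj_real (a : R) : (a%:C : R[i])^* = a%:C.
Proof. by rewrite /Num.conj /= oppr0. Qed.

Lemma ReD (y z : R[i]) : complex.Re (y + z) = complex.Re y + complex.Re z.
Proof. by case: y z => [a b] [c d]. Qed.

Lemma ReN (z : R[i]) : complex.Re (- z) = - complex.Re z.
Proof. by case: z. Qed.

Lemma Re_realM (a : R) (z : R[i]) : complex.Re (a%:C * z) = a * complex.Re z.
Proof. by case: z => c d /=; rewrite mul0r subr0. Qed.

Lemma Re_conj (z : R[i]) : complex.Re z^* = complex.Re z.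
Proof. by case: z. Qed.

Lemma normr_ltE (V : normedModType R[i]) (x : V) (e : R[i]) :
  (`|x| < e) = (0 < e) && (rnorm x < complex.Re e).
Proof.
case: (boolP (0 < e)) => [e0|/negP e0] /=.
  by rewrite normE {1}(ge0_ReE (ltW e0)) ltcR.
by apply/negP => /(le_lt_trans (normr_ge0 _)).
Qed.

End RealNorm.

Section Complete.
Variables (R : realType) (H : completeNormedModType R[i]).

Lemma rnorm_complete (u : nat -> H) :
  (forall e : R, 0 < e -> exists n0, forall m n, (n0 <= m)%N -> (n0 <= n)%N ->
     rnorm (u m - u n) < e) ->
  exists l, forall e : R, 0 < e -> exists n0, forall n, (n0 <= n)%N ->
     rnorm (u n - l) < e.
Proof.
move=> cu.
have : cauchy (u x @[x --> \oo]).
  apply: cauchy_exP => e e0.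
  have [|n0 un] := cu (complex.Re e); first by rewrite -ltcR -ge0_ReE ?ltW.
  exists (u n0); exists n0 => // n /= nn.
  by rewrite -ball_normE /ball_ /= normr_ltE e0 un.
move=> /cauchy_cvg /cvg_ex[l /cvgrPdist_lt ul]; exists l => e e0.
have [|n0 _ un] := ul e%:C; first by rewrite ltcR.
by exists n0 => n /un /=; rewrite normr_ltE rnorm_distC => /andP[].
Qed.

End Complete.

Section InnerProduct.
Variables (R : realType) (H : hilbertType R).
Implicit Types (x y z : H) (a : R[i]).

Lemma hdotDr x y z : hdot x (y + z) = hdot x y + hdot x z.
Proof. by rewrite -{1}(scale1r y) hdotPr mul1r. Qed.

Lemma hdot0r x : hdot x 0 = 0.
Proof. by apply: (addrI (hdot x 0)); rewrite -hdotDr !addr0. Qed.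

Lemma hdotZr a x y : hdot x (a *: y) = a * hdot x y.
Proof. by rewrite -(addr0 (a *: y)) hdotPr hdot0r addr0. Qed.

Lemma hdotNr x y : hdot x (- y) = - hdot x y.
Proof. by rewrite -scaleN1r hdotZr mulN1r. Qed.

Lemma hdotBr x y z : hdot x (y - z) = hdot x y - hdot x z.
Proof. by rewrite hdotDr hdotNr. Qed.

Lemma hdotDl x y z : hdot (x + y) z = hdot x z + hdot y z.
Proof. by rewrite hdotC hdotDr rmorphD /= -!hdotC. Qed.

Lemma hdot0l x : hdot 0 x = 0.
Proof. by rewrite hdotC hdot0r rmorph0. Qed.

Lemma hdotZl a x y : hdot (a *: x) y = a^* * hdot x y.
Proof. by rewrite hdotC hdotZr rmorphM /= -hdotC. Qed.

Lemma hdotNl x y : hdot (- x) y = - hdot x y.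
Proof. by rewrite hdotC hdotNr rmorphN /= -hdotC. Qed.

Lemma hdotBl x y z : hdot (x - y) z = hdot x z - hdot y z.
Proof. by rewrite hdotDl hdotNl. Qed.

Lemma hdot_sumr I (r : seq I) (p : pred I) x (f : I -> H) :
  hdot x (\sum_(i <- r | p i) f i) = \sum_(i <- r | p i) hdot x (f i).
Proof. by apply: (big_morph (hdot x)) => [y z|]; rewrite ?hdotDr ?hdot0r. Qed.

Lemma hdot_suml I (r : seq I) (p : pred I) x (f : I -> H) :
  hdot (\sum_(i <- r | p i) f i) x = \sum_(i <- r | p i) hdot (f i) x.
Proof.
by apply: (big_morph (fun y => hdot y x)) => [y z|]; rewrite ?hdotDl ?hdot0l.
Qed.

Lemma hdotxx x : hdot x x = (rnorm x ^+ 2)%:C.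
Proof. by rewrite hdot_norm normE rmorphXn. Qed.

Lemma rnorm_sqrD x y :
  rnorm (x + y) ^+ 2 = rnorm x ^+ 2 + complex.Re (hdot x y) *+ 2 + rnorm y ^+ 2.
Proof.
have -> : rnorm (x + y) ^+ 2 = complex.Re (hdot (x + y) (x + y)) by rewrite hdotxx.
rewrite !hdotDl !hdotDr !hdotxx !ReD /= (hdotC y x) Re_conj mulr2n.
ring.
Qed.

Lemma hdot_cauchy_schwarz x y : cabs (hdot x y) <= rnorm x * rnorm y.
Proof.
have [y0|y0] := eqVneq (rnorm y) 0.
  by rewrite (rnorm0_eq0 y0) hdot0r cabs0 rnorm0 mulr0.
have yp : 0 < rnorm y ^+ 2 by rewrite exprn_even_gt0.
(* The vector paired with itself is [rnorm y ^+ 2] times the component of [x] orthogonal to [y], a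
   form without division. *)
have key : hdot ((rnorm y ^+ 2)%:C *: x - hdot y x *: y)
                ((rnorm y ^+ 2)%:C *: x - hdot y x *: y)
   = (rnorm y ^+ 2 * ((rnorm x * rnorm y) ^+ 2 - cabs (hdot x y) ^+ 2))%:C.
  rewrite !hdotBl !hdotBr !hdotZl !hdotZr !hdotxx conj_real (hdotC y x) conjCK.
  rewrite !(rmorphM, rmorphB, rmorphXn (real_complex R)) /=.
  have <- : hdot x y * (hdot x y)^* = (cabs (hdot x y))%:C * (cabs (hdot x y))%:C.
    by rewrite mul_conj_cabs rmorphM.
  ring.
rewrite -(ler_pXn2r (n := 2)) ?nnegrE ?cabs_ge0 ?mulr_ge0 ?rnorm_ge0 //.
by rewrite -subr_ge0 -(pmulr_rge0 _ yp) -lecR -key hdotxx lecR sqr_ge0.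
Qed.

End InnerProduct.

(** * Riesz representation on a family of vectors *)

Section LinearCombinations.
Variables (K : pzRingType) (V : lmodType K) (I : Type).

(** Formal combinations are lists with repetitions allowed: they concatenate and scale without
    decidable equality on [I] or independence of [v]. *)
Definition lincomb (v : I -> V) (s : seq (K * I)) : V :=
  \sum_(p <- s) p.1 *: v p.2.

Definition lcscale (a : K) (s : seq (K * I)) : seq (K * I) :=
  [seq (a * p.1, p.2) | p <- s].

Lemma lincomb_cat v s t : lincomb v (s ++ t) = lincomb v s + lincomb v t.
Proof. exact: big_cat. Qed.

Lemma lincomb_scale v a s : lincomb v (lcscale a s) = a *: lincomb v s.
Proof.
rewrite /lincomb big_map scaler_sumr; apply: eq_bigr => p _.
by rewrite scalerA.
Qed.

Lemma lincomb_seq1 v p : lincomb v [:: p] = p.1 *: v p.2.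
Proof. exact: big_seq1. Qed.

End LinearCombinations.

Section Riesz.
Variables (R : realType) (H : hilbertType R).

Lemma natSinv_lt (e : R) : 0 < e ->
  exists n0, forall n, (n0 <= n)%N -> n.+1%:R^-1 < e.
Proof.
move=> e0; exists (Num.bound e^-1) => n nn.
have ep : 0 <= e^-1 by rewrite invr_ge0 ltW.
rewrite invf_plt ?posrE ?ltr0Sn //; apply: lt_le_trans (archi_boundP ep) _.
by rewrite ler_nat ltnW.
Qed.

Section Functional.
Variables (I : Type) (v : I -> H) (phi : I -> R[i]) (M : R).
Hypothesis phiM : forall s : seq (R[i] * I),
  cabs (lincomb (phi : I -> R[i]^o) s) <= M * rnorm (lincomb v s).

Let Phi (s : seq (R[i] * I)) : R[i] := lincomb (phi : I -> R[i]^o) s.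
(** If [g] represents [Phi], completing the square gives J = |x - g|^2 - |g|^2 at the vector x of
    [s]; minimizing [J] thus approximates the Riesz vector. *)
Let J s : R := rnorm (lincomb v s) ^+ 2 - complex.Re (Phi s) *+ 2.

Let Phi_cat s t : Phi (s ++ t) = Phi s + Phi t.
Proof. exact: lincomb_cat. Qed.

Let Phi_scale a s : Phi (lcscale a s) = a * Phi s.
Proof. exact: lincomb_scale. Qed.

Let J_ge s : - M ^+ 2 <= J s.
Proof.
have := phiM s; have := Re_le_cabs (Phi s); rewrite /J /Phi => h1 h2.
by have := sqr_ge0 (rnorm (lincomb v s) - M); nra.
Qed.

Let E : set R := range J.

Let hinf : has_inf E.
Proof.
split; first by exists (J [::]), [::].
by exists (- M ^+ 2) => _ [s _ <-]; apply: J_ge.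
Qed.

(** The midpoint [m] of the two combinations still has [J m] at least [inf E]. Hence minimizing
    sequences are Cauchy. *)
Let parallelogram s t :
  rnorm (lincomb v s - lincomb v t) ^+ 2 <=
  ((J s - inf E) + (J t - inf E)) *+ 2.
Proof.
pose m := lcscale (2%:R^-1)%:C (s ++ t).
have : inf E <= J m by apply: ge_inf; [case: hinf | exists m].
have eV : lincomb v m = (2%:R^-1)%:C *: (lincomb v s + lincomb v t).
  by rewrite lincomb_scale lincomb_cat.
rewrite /J Phi_scale Phi_cat eV rnormZ cabs_ger0 ?invr_ge0 ?ler0n //.
rewrite Re_realM ReD exprMn !rnorm_sqrD rnormN hdotNr ReN.
set a := rnorm _; set b := rnorm _; set c := complex.Re (hdot _ _).
set d := complex.Re _; set e := complex.Re _; 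
lra.
Qed.

(** The bound [phiM] makes [phi] well defined on the linear span even if the [v i] are dependent.
    The vector is the limit of a minimizing sequence of [J]; the span need not be dense. *)
Lemma riesz_family : 0 <= M ->
  exists2 g : H, rnorm g <= M & forall i, hdot g (v i) = phi i.
Proof.
move=> M0.
have /choice[s sP] : forall n, exists s, J s < inf E + n.+1%:R^-1.
  move=> n; have [|x [s _ <-] ?] := @inf_adherent R E (n.+1%:R^-1) _ hinf.
    by rewrite invr_gt0 ltr0Sn.
  by exists s.
have [|g gP] := rnorm_complete (u := fun n => lincomb v (s n)).
  move=> e e0.
  have [|n0 n0P] := natSinv_lt (e := e ^+ 2 / 4%:R).
    by rewrite divr_gt0 ?exprn_gt0 ?ltr0n.
  exists n0 => m n mm nn.
  rewrite -(ltr_pXn2r (n := 2)) ?nnegrE ?rnorm_ge0 ?(ltW e0) //.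
  apply: le_lt_trans (parallelogram _ _) _.
  have := n0P _ mm; have := n0P _ nn; have := sP m; have := sP n.
  move: (J _) (J _) (inf E) (n.+1%:R^-1) (m.+1%:R^-1) => a b c x y; lra.
(* First variation: adding [z *: v i] to a near-minimizer cannot push [J] below its infimum. The
   slack [e] absorbs the distance to the minimizer. *)
have var i z : 0 <= complex.Re (z * (hdot g (v i) - phi i)) *+ 2
                   + rnorm (z *: v i) ^+ 2.
  rewrite -(addr0 (_ + _)); apply/ler_addgt0Pr => e e0.
  pose r := rnorm (z *: v i).
  have r0 : 0 <= r by exact: rnorm_ge0.
  have [n1 n1P] := natSinv_lt (divr_gt0 e0 (ltr0n _ 2)).
  have [|n2 n2P] := gP (e / (4%:R * (r + 1))).
    by rewrite divr_gt0 ?mulr_gt0 ?ltr0n ?ltr_wpDl.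
  pose n := maxn n1 n2.
  have h1 := n1P n (leq_maxl _ _); have h2 := n2P n (leq_maxr _ _).
  have hs := sP n.
  have : inf E <= J (s n ++ [:: (z, i)]).
    by apply: ge_inf; [case: hinf | exists (s n ++ [:: (z, i)])].
  move: hs; rewrite /J Phi_cat lincomb_cat lincomb_seq1 /= rnorm_sqrD ReD -/r.
  have -> : Phi [:: (z, i)] = z * phi i by exact: (lincomb_seq1 (phi : I -> R[i]^o)).
  have h3 : complex.Re (hdot (lincomb v (s n) - g) (z *: v i)) * 4%:R <= e.
    have := hdot_cauchy_schwarz (lincomb v (s n) - g) (z *: v i).
    move=> /(le_trans (Re_le_cabs _)); rewrite -/r.
    move: h2; rewrite ltr_pdivlMr ?mulr_gt0 ?ltr0n ?ltr_wpDl //.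
    move: (rnorm _) (rnorm_ge0 (lincomb v (s n) - g)) (complex.Re _) => q q0 p.
    by nra.
  move: h3; rewrite hdotBl ReD ReN mulrBr ReD ReN -hdotZr.
  move: h1; set a := n.+1%:R^-1; rewrite -/r.
  lra.
have gphi i : hdot g (v i) = phi i.
  apply/eqP; rewrite -subr_eq0; apply/eqP/cabs0_eq0.
  set d := (X in cabs X).
  have d0 := cabs_ge0 d; have r0 := rnorm_ge0 (v i).
  (* For z = - t d^* the variation equals t |d|^2 (t |v i|^2 - 2). This [t] keeps t |v i|^2 below 1,
     which forces d = 0. *)
  pose t := (rnorm (v i) ^+ 2 + 1)^-1.
  have t0 : 0 < t by rewrite invr_gt0 ltr_wpDl ?sqr_ge0.
  have tE : t * (rnorm (v i) ^+ 2 + 1) = 1.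
    by rewrite mulVf // gt_eqF // ltr_wpDl ?sqr_ge0.
  have := var i (- t%:C * d^*).
  rewrite -/d -mulrA [d^* * d]mulrC mul_conj_cabs -rmorphN Re_realM /=.
  rewrite rnormZ cabsM cabs_conj rmorphN cabsN cabs_ger0 ?(ltW t0) //.
  rewrite !exprMn => h.
  apply/eqP; rewrite -sqrf_eq0 eq_le sqr_ge0 andbT.
  have : 0 <= t * (cabs d ^+ 2 * (t * rnorm (v i) ^+ 2 - 2%:R)) by nra.
  rewrite (pmulr_rge0 _ t0).
  have := sqr_ge0 (cabs d).
  by have : t * rnorm (v i) ^+ 2 < 1 by [lra]; nra.
exists g => //.
have gPhi t : hdot g (lincomb v t) = Phi t.
  rewrite /Phi /lincomb hdot_sumr; apply: eq_bigr => p _.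
  by rewrite hdotZr gphi.
have g0 := rnorm_ge0 g.
(* On the combinations converging to [g], [phiM] bounds the pairing with [g] by [M] times their
   norm; in the limit this bounds the pairing of [g] with itself. *)
suff : rnorm g ^+ 2 <= M * rnorm g.
  have [->|gn] := eqVneq (rnorm g) 0; first by [].
  by rewrite expr2 ler_pM2r // lt_neqAle eq_sym gn.
apply/ler_addgt0Pr => e e0.
have [|n nP] := gP (e / (rnorm g + M + 1)).
  by rewrite divr_gt0 // ltr_wpDl ?addr_ge0.
have := nP n (leqnn n).
rewrite ltr_pdivlMr ?ltr_wpDl ?addr_ge0 //.
have := phiM (s n); rewrite -/(Phi _) -gPhi => h1.
have := rnorm_triangle (lincomb v (s n)) g 0; rewrite !subr0 => h2.
have := hdot_cauchy_schwarz g (g - lincomb v (s n)).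
rewrite (rnorm_distC g) hdotBr hdotxx.
move=> /(le_trans (Re_le_cabs _)); rewrite ReD ReN /=.
have := le_trans (Re_le_cabs _) h1.
move: (rnorm (_ - _)) (rnorm_ge0 (lincomb v (s n) - g)) h2 => q q0 h2.
by nra.
Qed.

End Functional.

Lemma riesz (phi : H -> R[i]) (M : R) : 0 <= M ->
  (forall a x y, phi (a *: x + y) = a * phi x + phi y) ->
  (forall x, cabs (phi x) <= M * rnorm x) ->
  exists2 g : H, rnorm g <= M & forall x, phi x = hdot g x.
Proof.
move=> M0 philin phiM.
have [|//|g gM gP] := @riesz_family H id phi M; last by exists g.
move=> s; suff -> : lincomb (phi : H -> R[i]^o) s = phi (lincomb id s) by [].
have phi0 : phi 0 = 0.
  by apply: (addIr (phi 0)); rewrite -{1}(mul1r (phi 0)) -philin scaler0 !add0r.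
rewrite /lincomb; elim/big_rec2: _ => [//|p x y _ ->].
by rewrite philin.
Qed.

End Riesz.

(** * Elementary tensors in the Fock space *)

Section Density.
Variables (R : realType) (H : hilbertType R).
Implicit Types (A : set H) (x : H).

Lemma closure_rnorm A x : closure A x ->
  forall e : R, 0 < e -> exists2 v, A v & rnorm (x - v) < e.
Proof.
move=> Ax e e0; have [|v [Av xv]] := Ax (ball x e%:C).
  by apply/nbhs_ballP; exists e%:C => //=; rewrite ltcR.
by exists v => //; move: xv; rewrite -ball_normE /ball_ /= normr_ltE => /andP[].
Qed.

Lemma lin_span_mem A x : A x -> lin_span A x.
Proof.
by move=> Ax; exists 1%N, (fun=> 1), (fun=> x); split; rewrite // big_ord1 scale1r.
Qed.

Lemma lin_span_ind A (B : set H) : B 0 ->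
  (forall a x y, A x -> lin_span A y -> B y -> B (a *: x + y)) ->
  forall x, lin_span A x -> B x.
Proof.
move=> B0 Bs x [n [c [a [Aa ->]]]]; elim: n c a Aa => [|n IH] c a Aa.
  by rewrite big_ord0.
rewrite big_ord_recl; apply: Bs => //; last exact: IH.
by exists n, (fun i => c (lift ord0 i)), (fun i => a (lift ord0 i)).
Qed.

Lemma span_orth A x : (forall a, A a -> hdot a x = 0) ->
  forall v, lin_span A v -> hdot v x = 0.
Proof.
move=> Ax; apply: lin_span_ind => [|a v y /Ax v0 _ y0]; first exact: hdot0l.
by rewrite hdotDl hdotZl v0 y0 mulr0 addr0.
Qed.

(** If v in the span is within e of x, then |x|^2 = <x - v, x> <= e |x|. *)
Lemma dense_span_orth_eq0 A x : closure (lin_span A) = setT ->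
  (forall a, A a -> hdot a x = 0) -> x = 0.
Proof.
move=> Ad Ax; apply: rnorm0_eq0; apply/eqP; rewrite eq_le rnorm_ge0 andbT.
apply/ler_addgt0Pr => e e0; rewrite add0r.
have [|v sv vx] := @closure_rnorm (lin_span A) x _ e e0; first by rewrite Ad.
have [->|xn] := eqVneq (rnorm x) 0; first exact: ltW.
rewrite -(ler_pM2r (x := rnorm x)) ?lt_neqAle 1?eq_sym ?xn ?rnorm_ge0 // -expr2.
have := hdot_cauchy_schwarz (x - v) x.
rewrite hdotBl (span_orth Ax sv) subr0 hdotxx => /(le_trans (Re_le_cabs _)) /=.
move=> /le_trans; apply; rewrite ler_wpM2r ?rnorm_ge0 //; exact: ltW.
Qed.

End Density.

Section FockTensors.
Variables (R : realType) (H : hilbertType R) (P : forall n, htpower H n).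
Variables (w : nat -> R) (F : fock_space P w).
Hypothesis w_gt0 : forall n, 0 < w n.

Definition fock_tens n (x : 'I_n -> H) : F := fock_inj F (sym_tens P x).

Lemma sym_power_tens n (x : 'I_n -> H) : sym_power (sym_tens P x).
Proof. by apply/subset_closure/lin_span_mem; exists x. Qed.

(** Each pairing depends only on the relative permutation of the two symmetrizers, so one of the two
    factors 1/n! cancels. What remains is the normalized permanent of the Gram matrix. *)
Lemma hdot_sym_tens n (x y : 'I_n -> H) :
  hdot (sym_tens P x) (sym_tens P y) =
  (n`!%:R)^-1 * \sum_(s : 'S_n) \prod_i hdot (x i) (y (s i)).
Proof.
rewrite /sym_tens hdotZl hdotZr hdot_suml fmorphV rmorph_nat.
have -> : \sum_(s : 'S_n) hdot (hptens (P n) (fun i => x (s i)))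
    (\sum_(t : 'S_n) hptens (P n) (fun i => y (t i))) =
    \sum_(s : 'S_n) \sum_(t : 'S_n) \prod_i hdot (x i) (y (t i)).
  apply: eq_bigr => s _; rewrite hdot_sumr.
  rewrite (reindex_inj (mulgI s)) /=; apply: eq_bigr => t _.
  rewrite hptens_dot [RHS](reindex_inj (@perm_inj _ s)).
  by apply: eq_bigr => i _; rewrite permM.
rewrite sumr_const card_Sn -(mulr_natl (\sum__ _)) [X in _ * X]mulrA mulVf ?mul1r //.
by rewrite pnatr_eq0 -lt0n fact_gt0.
Qed.

Lemma hdot_fock_tens n (x y : 'I_n -> H) :
  hdot (fock_tens x) (fock_tens y) =
  (w n ^+ 2)%:C * ((n`!%:R)^-1 * \sum_(s : 'S_n) \prod_i hdot (x i) (y (s i))).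
Proof. by rewrite fock_dot ?hdot_sym_tens //; apply: sym_power_tens. Qed.

Lemma fock_tens_orth n m (x : 'I_n -> H) (y : 'I_m -> H) :
  n != m -> hdot (fock_tens x) (fock_tens y) = 0.
Proof. by move=> nm; apply: fock_orth => //; apply: sym_power_tens. Qed.

Lemma fock_inj0 n : fock_inj F (0 : P n) = 0.
Proof.
have s0 : sym_power (0 : P n).
  by apply: subset_closure; exists 0%N, (fun=> 0), (fun=> 0);
  split=> [[]//|]; rewrite big_ord0.
by have := fock_inj_linear F (-1) s0 s0; rewrite scaler0 addr0 scaleN1r addNr.
Qed.

(** Two closures are involved: [sym_power] is itself a closed span. The inner approximation survives
    [fock_inj] because that map multiplies distances in [sym_power] by [w n]. *)
Lemma fock_tens_total (f : F) :
  (forall n (x : 'I_n -> H), hdot (fock_tens x) f = 0) -> f = 0.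
Proof.
move=> f0; apply: dense_span_orth_eq0 (fock_dense F) _ => _ [n [s [ss ->]]].
have f_span v : lin_span (range (@sym_tens _ _ P n)) v -> hdot (fock_inj F v) f = 0.
  move: v; apply: lin_span_ind => [|a _ y [x _ <-] sy y0].
    by rewrite fock_inj0 hdot0l.
  rewrite fock_inj_linear ?hdotDl ?hdotZl ?y0 ?f0 ?mulr0 ?addr0 //.
    exact: sym_power_tens.
  exact: subset_closure.
apply: cabs0_eq0; apply/eqP; rewrite eq_le cabs_ge0 andbT.
have wf0 : 0 <= w n * rnorm f by rewrite mulr_ge0 ?rnorm_ge0 ?ltW.
apply/ler_addgt0Pr => e e0; rewrite add0r.
have [|v sv vx] := closure_rnorm ss (e := e / (w n * rnorm f + 1)).
  by rewrite divr_gt0 ?ltr_wpDl.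
have vs : sym_power v by apply: subset_closure.
have wE : rnorm (fock_inj F s - fock_inj F v) = w n * rnorm (s - v).
  apply/eqP; rewrite -(eqrXn2 (n := 2)) ?mulr_ge0 ?rnorm_ge0 ?ltW //.
  rewrite -(inj_eq (@complexI _)) -hdotxx exprMn rmorphM /= -hdotxx.
  by rewrite !hdotBl !hdotBr !fock_dot // !mulrBr.
have := hdot_cauchy_schwarz (fock_inj F s - fock_inj F v) f.
rewrite hdotBl (f_span v sv) subr0 wE => /le_trans; apply.
move: vx; rewrite ltr_pdivlMr ?ltr_wpDl // mulrDr mulr1 [w n * _]mulrC -mulrA.
by have := rnorm_ge0 (s - v); lra.
Qed.

Lemma fock_tens_eq (f g : F) :
  (forall n (x : 'I_n -> H), hdot f (fock_tens x) = hdot g (fock_tens x)) -> f = g.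
Proof.
move=> fg; apply/eqP; rewrite -subr_eq0; apply/eqP/fock_tens_total => n x.
by rewrite hdotC hdotBl fg subrr rmorph0.
Qed.

End FockTensors.

(** * Polarization *)

Section Polarization.
Variables (K : comNzRingType) (n : nat).

Lemma non_injective_miss (f : {ffun 'I_n -> 'I_n}) :
  ~~ injectiveb f -> exists j0, forall i, f i != j0.
Proof.
move=> fni; have : ~~ [forall j, j \in codom f].
  apply: contra fni => /forallP fs; apply/card_uniqP.
  by rewrite size_map -cardT; apply: eq_card => j; rewrite inE; apply: fs.
rewrite negb_forall => /existsP[j0 j0f]; exists j0 => i.
by apply: contra j0f => /eqP <-; apply: codom_f.
Qed.

(** If [f] misses some j0, the sign of j0 occurs exactly once and the sum over it cancels. If [f] is
    a bijection, every sign occurs squared and each of the 2^n terms is 1. *)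
Lemma sum_signs (f : {ffun 'I_n -> 'I_n}) :
  \sum_(t : {ffun 'I_n -> bool})
     (\prod_j (-1) ^+ (t j)) * \prod_i (-1) ^+ (t (f i)) =
  if injectiveb f then 2%:R ^+ n else 0 :> K.
Proof.
case: ifPn => [/injectiveP fi|/non_injective_miss[j0 fj0]].
  rewrite (eq_bigr (fun=> 1)) => [|t _].
    by rewrite sumr_const card_ffun card_bool card_ord -natrX.
  rewrite (reindex_inj fi) -big_split /=; apply: big1 => i _.
  by rewrite -expr2 sqrr_sign.
transitivity (\prod_j \sum_b
   ((-1) ^+ (b : bool) * \prod_(i | f i == j) (-1) ^+ b) : K).
  rewrite bigA_distr_bigA; apply: eq_bigr => t _; rewrite big_split /=.
  congr (_ * _); rewrite (partition_big f predT) //=.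
  by apply: eq_bigr => j _; apply: eq_bigr => i /eqP->.
rewrite (bigD1 j0) //= [X in X * _](_ : _ = 0) ?mul0r //.
rewrite big_bool /= !big_pred0 => [|i|i]; try exact: negbTE (fj0 i).
by rewrite !mulr1 expr0 expr1 addNr.
Qed.

(* Glynn's formula for the permanent; it is the polarization identity tested
   against elementary tensors. *)
Lemma glynn_permanent (A : 'I_n -> 'I_n -> K) :
  \sum_(t : {ffun 'I_n -> bool})
     (\prod_j (-1) ^+ (t j)) * \prod_i \sum_j (-1) ^+ (t j) * A i j =
  2%:R ^+ n * \sum_(s : 'S_n) \prod_i A i (s i).
Proof.
transitivity (\sum_(f : {ffun 'I_n -> 'I_n}) (\prod_i A i (f i)) *
    \sum_(t : {ffun 'I_n -> bool})
     ((\prod_j (-1) ^+ (t j)) * \prod_i (-1) ^+ (t (f i)))).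
  under [RHS]eq_bigr do rewrite mulr_sumr.
  rewrite [RHS]exchange_big /=; apply: eq_bigr => t _.
  rewrite bigA_distr_bigA /= mulr_sumr; apply: eq_bigr => f _.
  by rewrite big_split /=; ring.
under eq_bigr do rewrite sum_signs.
rewrite (bigID (fun f : {ffun 'I_n -> 'I_n} => injectiveb f)) /=.
rewrite [X in _ + X]big1 => [|f /negbTE->]; last by rewrite mulr0.
rewrite addr0 mulr_sumr (reindex (@pval _)) /=; last first.
  by exists (insubd (1%g : 'S_n)) => [s _|f fi]; [exact: valKd | exact: insubdK].
apply: eq_big => [s|s _]; first exact: (valP s).
rewrite (valP s : injectiveb (pval s)) mulrC; congr (_ * _).
by apply: eq_bigr => i _; rewrite pvalE.
Qed.

End Polarization.

(** * Symmetric powers of a single vector *)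

Section Powers.
Variables (R : realType) (H : hilbertType R) (P : forall n, htpower H n).
Variables (w : nat -> R) (F : fock_space P w).
Hypothesis w_gt0 : forall n, 0 < w n.

Definition fock_pow n (h : H) : F := fock_tens F (fun _ : 'I_n => h).

(* Normalized so that pairing with an elementary tensor has no weight. *)
Definition dual_pow n (h : H) : F := (w n ^- 2)%:C *: fock_pow n h.

Lemma hdot_fock_pow n (x : 'I_n -> H) h :
  hdot (fock_tens F x) (fock_pow n h) = (w n ^+ 2)%:C * \prod_i hdot (x i) h.
Proof.
rewrite hdot_fock_tens sumr_const card_Sn -(mulr_natl (\prod__ _)).
by rewrite [X in _ * X]mulrA mulVf ?mul1r // pnatr_eq0 -lt0n fact_gt0.
Qed.

Lemma hdot_dual_pow n m h (x : 'I_m -> H) :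
  hdot (dual_pow n h) (fock_tens F x) =
  (n == m)%:R * \prod_i hdot h (x i).
Proof.
rewrite hdotZl conj_real; case: eqVneq x => [<-|nm] x; last first.
  by rewrite fock_tens_orth // mulr0 mul0r.
rewrite hdotC hdot_fock_pow rmorphM /= conj_real rmorph_prod /= mulrA -rmorphM.
rewrite mulVf ?mul1r ?gt_eqF ?exprn_gt0 //.
by apply: eq_bigr => i _; rewrite -hdotC.
Qed.

Lemma hdot_dual_pow2 n m h k :
  hdot (dual_pow n h) (dual_pow m k) =
  (n == m)%:R * ((w n ^- 2)%:C * hdot h k ^+ n).
Proof.
rewrite [X in hdot _ X]/dual_pow hdotZr (hdot_dual_pow n h (fun=> k)).
rewrite prodr_const card_ord.
by case: eqVneq => [->|_]; rewrite ?mul0r ?mulr0 ?mul1r.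
Qed.

Lemma rnorm_dual_pow n h : rnorm (dual_pow n h) ^+ 2 = w n ^- 2 * rnorm h ^+ n ^+ 2.
Proof.
apply: complexI; rewrite -hdotxx hdot_dual_pow2 eqxx mul1r hdotxx.
by rewrite -rmorphXn -rmorphM exprAC.
Qed.

Lemma dual_powZ n c h : dual_pow n (c *: h) = c ^+ n *: dual_pow n h.
Proof.
apply: (fock_tens_eq w_gt0) => m x; rewrite (hdotZl (c ^+ n)) !hdot_dual_pow mulrCA.
case: eqVneq => [->|_]; rewrite ?mul0r // !mul1r rmorphXn.
under eq_bigr do rewrite hdotZl.
by rewrite big_split /= prodr_const card_ord.
Qed.

Lemma polarization n (x : 'I_n -> H) :
  (2%:R ^+ n * n`!%:R) *: fock_tens F x =
  \sum_(t : {ffun 'I_n -> bool})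
     (\prod_j (-1) ^+ (t j)) *: fock_pow n (\sum_j (-1) ^+ (t j) *: x j).
Proof.
apply/eqP; rewrite -subr_eq0; apply/eqP/(fock_tens_total w_gt0) => m y.
rewrite hdotBr hdotZr hdot_sumr.
under eq_bigr do rewrite hdotZr.
case: (eqVneq m n) y => [->|mn] y; last first.
  rewrite fock_tens_orth // mulr0 big1 ?subrr // => t _.
  by rewrite fock_tens_orth ?mulr0.
rewrite hdot_fock_tens.
rewrite [X in _ - X](eq_bigr (fun t : {ffun 'I_n -> bool} => (w n ^+ 2)%:C *
    ((\prod_j (-1) ^+ (t j)) *
     \prod_i \sum_j (-1) ^+ (t j) * hdot (y i) (x j)))); last first.
  move=> t _; rewrite hdot_fock_pow mulrCA; congr (_ * (_ * _)).
  apply: eq_bigr => i _; rewrite hdot_sumr; apply: eq_bigr => j _.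
  exact: hdotZr.
rewrite -mulr_sumr glynn_permanent; apply/eqP; rewrite subr_eq0; apply/eqP.
have n0 : n`!%:R != 0 :> R[i] by rewrite pnatr_eq0 -lt0n fact_gt0.
by field.
Qed.

Lemma dual_pow_total (f : F) :
  (forall n h, hdot (dual_pow n h) f = 0) -> f = 0.
Proof.
move=> f0; apply: (fock_tens_total w_gt0) => n x.
have n0 : (2%:R ^+ n * n`!%:R)^* != 0 :> R[i].
  by rewrite conjC_eq0 mulf_neq0 ?expf_neq0 ?pnatr_eq0 // -lt0n fact_gt0.
apply: (mulfI n0); rewrite mulr0 -hdotZl polarization hdot_suml big1 // => t _.
rewrite hdotZl; suff -> : hdot (fock_pow n (\sum_j (-1) ^+ (t j) *: x j)) f = 0.
  by rewrite mulr0.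
have wn : (w n ^- 2)%:C != 0 :> R[i].
  by rewrite (inj_eq (@complexI _)) invr_eq0 expf_neq0 // gt_eqF.
by apply: (mulfI wn); rewrite mulr0 -{1}(conj_real (w n ^- 2)) -hdotZl f0.
Qed.

Lemma dual_pow_eq (f g : F) :
  (forall n h, hdot (dual_pow n h) f = hdot (dual_pow n h) g) -> f = g.
Proof.
move=> fg; apply/eqP; rewrite -subr_eq0; apply/eqP/dual_pow_total => n h.
by rewrite hdotBr fg subrr.
Qed.

End Powers.

(** * A Cauchy-Schwarz inequality for tensors *)

Section GramSchmidt.
Variables (R : realType) (H : hilbertType R).
Implicit Types (e q : seq H) (v g : H).

Definition fourier e v : H := \sum_(x <- e) hdot x v *: x.

(** Orthogonality of the remainder [g - fourier e g] to [e] is all that [bessel] asks for, so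
    orthonormality of [e] is not recorded. *)
Lemma gram_schmidt q : exists e,
  (forall g, {in e, forall x, hdot x (g - fourier e g) = 0}) /\
  {in q, forall v, v = fourier e v}.
Proof.
elim: q => [|v q [e [eo eq]]]; first by exists [::].
pose r := v - fourier e v.
have [r0|rn] := eqVneq (rnorm r) 0.
  exists e; split=> // y; rewrite inE => /orP[/eqP->|]; last exact: eq.
  by apply/eqP; rewrite -subr_eq0; apply/eqP/rnorm0_eq0.
pose u := (rnorm r)^-1%:C *: r.
have xu x : x \in e -> hdot x u = 0 by move=> xe; rewrite hdotZr eo ?mulr0.
have ux x : x \in e -> hdot u x = 0 by move=> xe; rewrite hdotC xu ?rmorph0.
have ue y : hdot u (fourier e y) = 0.
  rewrite hdot_sumr big_seq big1 // => x xe; by rewrite hdotZr ux ?mulr0.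
have uu : hdot u u = 1.
  rewrite hdotZl hdotZr conj_real hdotxx -!rmorphM.
  by rewrite (_ : _ * _ = 1) ?rmorph1 //; field.
have uF y : fourier (u :: e) y = hdot u y *: u + fourier e y.
  by rewrite /fourier big_cons.
exists (u :: e); split=> [g x|y]; rewrite inE => /orP[/eqP->|].
- by rewrite uF hdotBr hdotDr hdotZr uu ue mulr1 addr0 subrr.
- move=> xe; rewrite uF opprD addrCA hdotDr eo // hdotNr hdotZr xu //.
  by rewrite mulr0 oppr0 addr0.
- have uv : hdot u v = (rnorm r)%:C.
    rewrite -[v](subrK (fourier e v)) -/r hdotDr ue addr0 hdotZl conj_real hdotxx.
    by rewrite -rmorphM; congr (_%:C); field.
  by rewrite uF uv scalerA -rmorphM /= divff // scale1r subrK.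
- move=> yq; rewrite uF -(eq y yq) [in hdot u y](eq y yq) ue scale0r.
  by rewrite add0r.
Qed.

Lemma bessel e g : {in e, forall x, hdot x (g - fourier e g) = 0} ->
  \sum_(x <- e) cabs (hdot x g) ^+ 2 <= rnorm g ^+ 2.
Proof.
move=> eg; have fo : hdot (fourier e g) (g - fourier e g) = 0.
  by rewrite hdot_suml big_seq big1 // => x xe; rewrite hdotZl eg ?mulr0.
have -> : \sum_(x <- e) cabs (hdot x g) ^+ 2 = rnorm (fourier e g) ^+ 2.
  apply: complexI; rewrite -hdotxx -[X in hdot _ X](subKr g) hdotBr fo subr0.
  rewrite hdot_suml rmorph_sum; apply: eq_bigr => x _.
  by rewrite hdotZl mulrC mul_conj_cabs.
rewrite -[in leRHS](subrKC (fourier e g) g) rnorm_sqrD fo mul0rn addr0.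
by rewrite lerDl sqr_ge0.
Qed.

End GramSchmidt.

Lemma discrete_cauchy_schwarz (R : realDomainType) (I : Type) (r : seq I) (a b : I -> R) :
  (\sum_(i <- r) a i * b i) ^+ 2 <=
  (\sum_(i <- r) a i ^+ 2) * (\sum_(i <- r) b i ^+ 2).
Proof.
have sq0 (c : I -> R) s : 0 <= \sum_(i <- s) c i ^+ 2.
  by apply: sumr_ge0 => i _; apply: sqr_ge0.
elim: r => [|i r IH]; first by rewrite !big_nil mul0r expr0n.
rewrite !big_cons.
move: IH (sq0 a r) (sq0 b r).
move: (\sum_(_ <- _) _) (\sum_(_ <- _) _) (\sum_(_ <- _) _) => B A S IH A0 B0.
move: (a i) (b i) => {}a {}b.
(* After squaring this is the inequality between arithmetic and geometric means for A b^2 and a^2 B,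
   combined with S^2 <= A B. *)
suff : a * b * S *+ 2 <= A * b ^+ 2 + a ^+ 2 * B by nra.
have Y0 : 0 <= A * b ^+ 2 + a ^+ 2 * B by rewrite addr_ge0 // mulr_ge0 ?sqr_ge0.
apply: le_trans (ler_norm _) _.
rewrite -(ler_pXn2r (n := 2)) ?nnegrE // real_normK ?num_real //.
rewrite -mulr_natl !exprMn.
have := sqr_ge0 (A * b ^+ 2 - a ^+ 2 * B).
have : (a * b) ^+ 2 * S ^+ 2 <= (a * b) ^+ 2 * (A * B).
  by rewrite ler_wpM2l ?sqr_ge0.
by rewrite exprMn; nra.
Qed.

Section TensorCauchySchwarz.
Variables (R : realType) (H1 H2 : hilbertType R) (J : eqType).
Implicit Types (r : seq J) (c : J -> R[i]) (p : J -> H1) (q : J -> H2).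

(* The squared norm of [\sum_j c j *: (p j (x) q j)] in H1 (x) H2. *)
Definition tens_sqnorm r c p q : R[i] :=
  \sum_(j <- r) \sum_(k <- r)
     (c j)^* * c k * (hdot (p j) (p k) * hdot (q j) (q k)).

(** Expanding the [q j] in a Gram-Schmidt family [e] turns the formal tensor into the sum over x in
    [e] of v x (x) x, whose squared norm is the sum of the |v x|^2. Cauchy-Schwarz for sums and
    Bessel for [g] finish the estimate. *)
Lemma tensor_cauchy_schwarz r c p q f g :
  cabs (\sum_(j <- r) c j * (hdot f (p j) * hdot g (q j))) ^+ 2 <=
  rnorm f ^+ 2 * rnorm g ^+ 2 * complex.Re (tens_sqnorm r c p q).
Proof.
have [e [eo eq]] := gram_schmidt [seq q j | j <- r].
have qE j : j \in r -> q j = fourier e (q j) by move=> jr; apply/eq/map_f.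
pose v x := \sum_(j <- r) (c j * hdot x (q j)) *: p j.
have -> : tens_sqnorm r c p q = (\sum_(x <- e) rnorm (v x) ^+ 2)%:C.
  rewrite rmorph_sum /=; under [RHS]eq_bigr do rewrite -hdotxx.
  under [RHS]eq_bigr => x _.
    rewrite hdot_suml; under eq_bigr do rewrite hdot_sumr; over.
  rewrite [RHS]exchange_big /=; apply: eq_bigr => j _.
  rewrite [RHS]exchange_big /= big_seq [RHS]big_seq; apply: eq_bigr => k kr.
  rewrite [in hdot (q j) _](qE k kr) hdot_sumr !mulr_sumr.
  apply: eq_bigr => x _; rewrite hdotZl !hdotZr rmorphM /= -(hdotC (q j) x).
  by ring.
have -> : \sum_(j <- r) c j * (hdot f (p j) * hdot g (q j)) =
          \sum_(x <- e) hdot g x * hdot f (v x).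
  under [RHS]eq_bigr do rewrite hdot_sumr mulr_sumr.
  rewrite [RHS]exchange_big /= big_seq [RHS]big_seq; apply: eq_bigr => j jr.
  rewrite [in hdot g _](qE j jr) hdot_sumr !mulr_sumr.
  by apply: eq_bigr => x _; rewrite !hdotZr; ring.
have h1 : cabs (\sum_(x <- e) hdot g x * hdot f (v x)) <=
    rnorm f * \sum_(x <- e) cabs (hdot x g) * rnorm (v x).
  rewrite mulr_sumr; elim/big_rec2: _ => [|x a b _ ab]; first by rewrite cabs0.
  apply: le_trans (cabsD _ _) (lerD _ ab); rewrite cabsM hdotC cabs_conj mulrCA.
  by rewrite ler_wpM2l ?cabs_ge0 // hdot_cauchy_schwarz.
apply: (@le_trans _ _ ((rnorm f * \sum_(x <- e) cabs (hdot x g) * rnorm (v x)) ^+ 2)).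
  by rewrite ler_pXn2r ?nnegrE ?cabs_ge0 ?(le_trans (cabs_ge0 _) h1).
rewrite exprMn -mulrA ler_wpM2l ?sqr_ge0 //.
apply: le_trans (discrete_cauchy_schwarz _ _ _) _.
rewrite ler_wpM2r ?bessel //; first by apply: sumr_ge0 => x _; apply: sqr_ge0.
Qed.

End TensorCauchySchwarz.

(** * Boundedness of the coproduct *)

Section Coproduct.
Variables (R : realType) (H : hilbertType R) (P : forall n, htpower H n).
Variables (w : nat -> R) (F : fock_space P w).
Hypothesis w_gt0 : forall n, 0 < w n.
Variable C : R.
Hypothesis w_conv : forall n,
  \sum_(k < n.+1) (w k) ^- 2 * (w (n - k)%N) ^- 2 <= C * (w n) ^- 2.

Local Notation eta := (dual_pow F).

Let eta2 (a : nat * H) : F := eta a.1 a.2.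

Let conv n := \sum_(k < n.+1) (w k) ^- 2 * (w (n - k)%N) ^- 2.

(* [dual_pow n h] is mapped to [\sum_(k <= n) dual_pow k h (x) dual_pow (n - k) h],
   the image under the adjoint of the multiplication. *)
Definition coproduct (s : seq (R[i] * (nat * H))) : seq (R[i] * (F * F)) :=
  [seq (a.1, (eta k a.2.2, eta (a.2.1 - k) a.2.2)) |
     a <- s, k <- index_iota 0 a.2.1.+1].

Lemma big_coproduct (V : nmodType) (G : R[i] * (F * F) -> V) s :
  \sum_(t <- coproduct s) G t =
  \sum_(a <- s) \sum_(k < a.2.1.+1)
     G (a.1, (eta k a.2.2, eta (a.2.1 - k) a.2.2)).
Proof.
rewrite /coproduct big_allpairs_dep /=; apply: eq_bigr => a _.
by rewrite big_mkord.
Qed.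

Let conv_gram n m h k :
  \sum_(i < n.+1) \sum_(j < m.+1)
     hdot (eta i h) (eta j k) * hdot (eta (n - i) h) (eta (m - j) k) =
  (n == m)%:R * ((conv n)%:C * hdot h k ^+ n).
Proof.
have [<-|nm] := eqVneq n m; last first.
  rewrite mul0r big1 // => i _; rewrite big1 // => j _; rewrite !hdot_dual_pow2 //.
  case: eqVneq => [ij|_]; last by rewrite !mul0r.
  case: eqVneq => [nimj|_]; last by rewrite mul0r mulr0.
  case/eqP: nm; have := leq_ord i; have := leq_ord j; move: ij nimj.
  by move: (i : nat) (j : nat) => i' j' <-; lia.
rewrite mul1r rmorph_sum mulr_suml; apply: eq_bigr => i _.
rewrite (bigD1 i) //= !hdot_dual_pow2 // !eqxx !mul1r big1 ?addr0 => [|j ji].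
  have -> : hdot h k ^+ n = hdot h k ^+ i * hdot h k ^+ (n - i).
    by rewrite -exprD subnKC // leq_ord.
  by rewrite rmorphM /=; ring.
rewrite !hdot_dual_pow2 //; case: eqVneq => [ij|_]; last by rewrite !mul0r.
by case/eqP: ji; apply: val_inj.
Qed.

(** A kernel delta_nm c(n) <h,k>^n with c >= 0 is positive because it is the Gram kernel of rescaled
    dual powers. In [coproduct_bound] this is applied to c = w^-2 and to the difference of the two
    sides. *)
Let gram_weighted (c : nat -> R) (s : seq (R[i] * (nat * H))) :
  (forall n, 0 <= c n) ->
  (rnorm (lincomb (fun a => (Num.sqrt (c a.1) * w a.1)%:C *: eta2 a) s) ^+ 2)%:C =
  \sum_(a <- s) \sum_(b <- s) (a.1)^* * b.1 *
     ((a.2.1 == b.2.1)%:R * ((c a.2.1)%:C * hdot a.2.2 b.2.2 ^+ a.2.1)).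
Proof.
move=> c0; rewrite -hdotxx hdot_suml; apply: eq_bigr => a _.
rewrite hdot_sumr; apply: eq_bigr => b _.
rewrite 2!hdotZr 2!hdotZl conj_real /eta2 hdot_dual_pow2 //.
case: eqVneq => [->|_]; last by rewrite !mul0r !mulr0.
set q := Num.sqrt _; have -> : c b.2.1 = q * w b.2.1 * (q * w b.2.1) * w b.2.1 ^- 2.
  rewrite -(sqr_sqrtr (c0 b.2.1)) -/q; field.
  by rewrite gt_eqF.
by rewrite !rmorphM /=; ring.
Qed.

Lemma coproduct_bound s :
  complex.Re (tens_sqnorm (coproduct s) (fun t => t.1) (fun t => t.2.1) (fun t => t.2.2))
  <= C * rnorm (lincomb eta2 s) ^+ 2.
Proof.
have -> : tens_sqnorm (coproduct s) (fun t => t.1) (fun t => t.2.1) (fun t => t.2.2) =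
  \sum_(a <- s) \sum_(b <- s) (a.1)^* * b.1 *
     ((a.2.1 == b.2.1)%:R * ((conv a.2.1)%:C * hdot a.2.2 b.2.2 ^+ a.2.1)).
  rewrite /tens_sqnorm big_coproduct; apply: eq_bigr => a _.
  under eq_bigr do rewrite big_coproduct.
  rewrite exchange_big; apply: eq_bigr => b _ /=.
  by rewrite -conv_gram mulr_sumr; apply: eq_bigr => i _; rewrite mulr_sumr.
have conv0 n : 0 <= C * w n ^- 2 - conv n by rewrite subr_ge0; apply: w_conv.
have w0 n : 0 <= w n ^- 2 by rewrite invr_ge0 exprn_ge0 // ltW.
have -> : lincomb eta2 s =
    lincomb (fun a => (Num.sqrt (w a.1 ^- 2) * w a.1)%:C *: eta2 a) s.
  apply: eq_bigr => p _; rewrite -exprVn sqrtr_sqr ger0_norm ?invr_ge0 ?ltW //.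
  by rewrite mulVf ?gt_eqF // scale1r.
have /(congr1 (@complex.Re R)) /= -> := gram_weighted s w0.
rewrite -subr_ge0 -Re_realM -ReN -ReD.
rewrite (_ : _ - _ = (rnorm (lincomb
   (fun a => (Num.sqrt (C * w a.1 ^- 2 - conv a.1) * w a.1)%:C *: eta2 a) s) ^+ 2)%:C).
  exact: sqr_ge0.
rewrite (gram_weighted _ conv0) mulr_sumr -sumrB; apply: eq_bigr => a _.
rewrite mulr_sumr -sumrB; apply: eq_bigr => b _.
by rewrite rmorphB rmorphM /=; ring.
Qed.

Lemma conv_const_ge0 : 0 <= C.
Proof.
have := w_conv 0; rewrite big_ord1 subn0 => h.
have w2 : 0 < w 0%N ^- 2 by rewrite invr_gt0 exprn_gt0.
by rewrite -(pmulr_lge0 _ w2) (le_trans _ h) // mulr_ge0 // ltW.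
Qed.

Lemma fock_mul_exists (f g : F) : exists2 u : F,
  rnorm u <= Num.sqrt C * rnorm f * rnorm g &
  forall n h, hdot (eta n h) u =
    \sum_(k < n.+1) hdot (eta k h) f * hdot (eta (n - k) h) g.
Proof.
pose phi (a : nat * H) :=
  \sum_(k < a.1.+1) hdot f (eta k a.2) * hdot g (eta (a.1 - k) a.2).
have K0 : 0 <= Num.sqrt C * rnorm f * rnorm g.
  by rewrite !mulr_ge0 ?sqrtr_ge0 ?rnorm_ge0.
have [s|//|u uM uP] := @riesz_family R F _ eta2 phi (Num.sqrt C * rnorm f * rnorm g).
  rewrite -(ler_pXn2r (n := 2)) ?nnegrE ?cabs_ge0 ?mulr_ge0 ?rnorm_ge0 ?sqrtr_ge0 //.
  have -> : lincomb (phi : _ -> R[i]^o) s = \sum_(t <- coproduct s)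
      t.1 * (hdot f t.2.1 * hdot g t.2.2).
    by rewrite big_coproduct; apply: eq_bigr => a _; rewrite -mulr_sumr.
  apply: le_trans (tensor_cauchy_schwarz _ _ _ _ _ _) _.
  rewrite !exprMn sqr_sqrtr ?conv_const_ge0 //.
  rewrite -[_ * _ * _]mulrA -[leRHS]mulrA -[leRHS]mulrA [leRHS]mulrCA.
  rewrite ler_wpM2l ?sqr_ge0 // [leRHS]mulrCA ler_wpM2l ?sqr_ge0 //.
  exact: coproduct_bound.
exists u => // n h; rewrite hdotC (uP (n, h)) rmorph_sum; apply: eq_bigr => k _.
by rewrite rmorphM /= -!hdotC.
Qed.

End Coproduct.

(** * The symmetric tensor product *)

Section Multiplication.
Variables (R : realType) (H : hilbertType R) (P : forall n, htpower H n).
Variables (w : nat -> R) (F : fock_space P w).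
Hypothesis w_gt0 : forall n, 0 < w n.

Local Notation eta := (dual_pow F).
Local Notation e x := (fock_tens F x).

Lemma prod_ord_cat n m (x : 'I_n -> H) (y : 'I_m -> H) h :
  \prod_i hdot h (ord_cat x y i) =
  (\prod_i hdot h (x i)) * \prod_i hdot h (y i).
Proof.
rewrite big_split_ord /ord_cat; congr (_ * _); apply: eq_bigr => i _.
  by rewrite (unsplitK (inl i)).
by rewrite (unsplitK (inr i)).
Qed.

(** A dual power of degree k sees only tensors of degree k, so the single term k = n can survive,
    and only if N = n + m. *)
Lemma dual_pow_cat N h n m (x : 'I_n -> H) (y : 'I_m -> H) :
  hdot (eta N h) (e (ord_cat x y)) =
  \sum_(k < N.+1) hdot (eta k h) (e x) * hdot (eta (N - k) h) (e y).
Proof.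
rewrite hdot_dual_pow // prod_ord_cat.
under [RHS]eq_bigr do rewrite !hdot_dual_pow // mulrACA.
rewrite -mulr_suml; congr (_ * _).
have [->|Nnm] := eqVneq N (n + m)%N.
  have nm : (n < (n + m).+1)%N by rewrite ltnS leq_addr.
  rewrite (bigD1 (Ordinal nm)) //= addKn !eqxx mulr1 big1 ?addr0 // => k kn.
  case: eqVneq => [kE|_]; last by rewrite mul0r.
  by case/eqP: kn; apply: val_inj.
rewrite big1 // => k _; case: eqVneq => [kn|_]; last by rewrite mul0r.
case: eqVneq => [Nk|_]; last by rewrite mulr0.
by case/eqP: Nnm; rewrite -kn -Nk subnKC // -ltnS.
Qed.

(** The constant in [bounded_map2] is any element of [R[i]]; its modulus is a real bound. *)
Lemma bounded_map2_real (U V W : normedModType R[i]) (f : U -> V -> W) :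
  bounded_map2 f -> exists2 M : R, 0 <= M &
    forall x y, rnorm (f x y) <= M * rnorm x * rnorm y.
Proof.
case=> M fM; exists (cabs M); first exact: cabs_ge0.
move=> x y; have := fM x y; rewrite !normE lecE => /andP[_] /= /le_trans; apply.
rewrite -mulrA -rmorphM mulrC Re_realM mulrC -mulrA ler_wpM2r ?Re_le_cabs //.
by rewrite mulr_ge0 ?rnorm_ge0.
Qed.

Section IsVee.
Variable vee : F -> F -> F.
Hypothesis veeP : is_vee vee.

Lemma vee_linl f g h a : vee (a *: f + g) h = a *: vee f h + vee g h.
Proof. by case: veeP => -[vl _] _ _; apply: vl. Qed.

Lemma vee_linr f g h a : vee h (a *: f + g) = a *: vee h f + vee h g.
Proof. by case: veeP => -[_ vr] _ _; apply: vr. Qed.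

Lemma vee_tens n m (x : 'I_n -> H) (y : 'I_m -> H) :
  vee (e x) (e y) = e (ord_cat x y).
Proof. by case: veeP => _ _; apply. Qed.

(** Boundedness extends the identity from elementary tensors, one slot at a time: with the other
    slot frozen both sides have Riesz vectors, which agree on a total family. The sum has n + 1
    terms for a dual power of degree n and one term for a coherent vector. *)
Lemma vee_form (xi : F) (J : Type) (r : seq J) (p q : J -> F) :
  (forall n m (x : 'I_n -> H) (y : 'I_m -> H), hdot xi (e (ord_cat x y)) =
     \sum_(j <- r) hdot (p j) (e x) * hdot (q j) (e y)) ->
  forall f g, hdot xi (vee f g) = \sum_(j <- r) hdot (p j) f * hdot (q j) g.
Proof.
move=> xie; have [_ /bounded_map2_real[M M0 vM] _] := veeP.
have bndl g : exists a, forall f, hdot xi (vee f g) = hdot a f.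
  have [||f|a _ aP] := @riesz R F (fun f => hdot xi (vee f g)) (rnorm xi * (M * rnorm g)).
  - by rewrite !mulr_ge0 ?rnorm_ge0.
  - by move=> a x y; rewrite vee_linl hdotPr.
  - apply: le_trans (hdot_cauchy_schwarz _ _) _.
    by rewrite -mulrA ler_wpM2l ?rnorm_ge0 // mulrAC.
  - by exists a.
have bndr f : exists a, forall g, hdot xi (vee f g) = hdot a g.
  have [||g|a _ aP] := @riesz R F (fun g => hdot xi (vee f g)) (rnorm xi * (M * rnorm f)).
  - by rewrite !mulr_ge0 ?rnorm_ge0.
  - by move=> a x y; rewrite vee_linr hdotPr.
  - apply: le_trans (hdot_cauchy_schwarz _ _) _.
    by rewrite -mulrA ler_wpM2l ?rnorm_ge0.
  - by exists a.
have half m (y : 'I_m -> H) f :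
    hdot xi (vee f (e y)) = \sum_(j <- r) hdot (p j) f * hdot (q j) (e y).
  have [a aP] := bndl (e y).
  rewrite aP (_ : a = \sum_(j <- r) (hdot (q j) (e y))^* *: p j).
    rewrite hdot_suml; apply: eq_bigr => j _.
    by rewrite hdotZl conjCK mulrC.
  apply: (fock_tens_eq w_gt0) => n x.
  rewrite -aP vee_tens xie hdot_suml; apply: eq_bigr => j _.
  by rewrite hdotZl conjCK mulrC.
move=> f g; have [a aP] := bndr f.
rewrite aP (_ : a = \sum_(j <- r) (hdot (p j) f)^* *: q j).
  by rewrite hdot_suml; apply: eq_bigr => j _; rewrite hdotZl conjCK.
apply: (fock_tens_eq w_gt0) => m y.
by rewrite -aP half hdot_suml; apply: eq_bigr => j _; rewrite hdotZl conjCK.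
Qed.

Lemma vee_dual_pow f g n h : hdot (eta n h) (vee f g) =
  \sum_(k < n.+1) hdot (eta k h) f * hdot (eta (n - k) h) g.
Proof. by apply: vee_form => *; apply: dual_pow_cat. Qed.

End IsVee.

Lemma is_vee_unique (vee vee' : F -> F -> F) : is_vee vee -> is_vee vee' -> vee = vee'.
Proof.
move=> v v'; apply/funext => f; apply/funext => g.
by apply: (dual_pow_eq w_gt0) => n h; rewrite !vee_dual_pow.
Qed.

Lemma is_vee_exists (C : R) :
  (forall n, \sum_(k < n.+1) (w k) ^- 2 * (w (n - k)%N) ^- 2 <= C * (w n) ^- 2) ->
  exists vee : F -> F -> F, is_vee vee.
Proof.
move=> w_conv.
have /choice[vee veeE] : forall fg : F * F, exists u : F,
    rnorm u <= Num.sqrt C * rnorm fg.1 * rnorm fg.2 /\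
    forall n h, hdot (eta n h) u =
      \sum_(k < n.+1) hdot (eta k h) fg.1 * hdot (eta (n - k) h) fg.2.
  by move=> [f g]; have [u] := fock_mul_exists w_gt0 w_conv f g; exists u.
exists (fun f g => vee (f, g)); split.
- split=> [g a f f'|f a g g']; apply: (dual_pow_eq w_gt0) => n h.
    rewrite hdotPr !(veeE _).2 /= mulr_sumr -big_split; apply: eq_bigr => k _ /=.
    by rewrite hdotPr; ring.
  rewrite hdotPr !(veeE _).2 /= mulr_sumr -big_split; apply: eq_bigr => k _ /=.
  by rewrite hdotPr; ring.
- exists (Num.sqrt C)%:C => f g.
  by rewrite !normE -!rmorphM lecR; apply: (veeE (f, g)).1.
- move=> n m x y; apply: (dual_pow_eq w_gt0) => k h.
  by rewrite (veeE _).2 dual_pow_cat.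
Qed.

End Multiplication.

(** * Coherent vectors *)

Section CoherentVectors.
Variables (R : realType) (H : hilbertType R) (P : forall n, htpower H n).
Variables (w : nat -> R) (F : fock_space P w).
Hypothesis w_gt0 : forall n, 0 < w n.
Hypothesis w_l2 : cvgn (series (fun n => (w n)^-1 ^+ 2)).

Local Notation eta := (dual_pow F).
Local Notation e x := (fock_tens F x).

(* For |h| <= 1 such a vector exists and represents the character
   [x1 \/ ... \/ xn |-> <h, x1> ... <h, xn>]. *)
Definition coherent (h : H) (xi : F) :=
  forall n (x : 'I_n -> H), hdot xi (e x) = \prod_i hdot h (x i).

Lemma l2_bound : exists2 M : R, 0 <= M &
  forall N, \sum_(n < N) w n ^- 2 <= M ^+ 2.
Proof.
pose l := limn (series (fun n => (w n)^-1 ^+ 2)).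
have sl N : \sum_(n < N) w n ^- 2 <= l.
  have -> : \sum_(n < N) w n ^- 2 = series (fun n => (w n)^-1 ^+ 2) N.
    by rewrite /series /= big_mkord; apply: eq_bigr => n _; rewrite exprVn.
  apply: nondecreasing_cvgn_le => //.
  by apply: nondecreasing_series => n _ _; exact: sqr_ge0.
have l0 : 0 <= l by have := sl 0%N; rewrite big_ord0.
by exists (Num.sqrt l) => [|N]; rewrite ?sqrtr_ge0 // sqr_sqrtr.
Qed.

Section Weighted.
Variables (a : nat -> R[i]) (h : H).

Let trunc N : F := \sum_(n < N) (a n)^* *: eta n h.

Let hdot_trunc N m (x : 'I_m -> H) : (m < N)%N ->
  hdot (trunc N) (e x) = a m * \prod_i hdot h (x i).
Proof.
move=> mN; rewrite hdot_suml (bigD1 (Ordinal mN)) //= big1 ?addr0 => [|n nm].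
  by rewrite (hdotZl _ (eta m h)) conjCK hdot_dual_pow // eqxx mul1r.
rewrite (hdotZl _ (eta n h)) hdot_dual_pow //; case: eqVneq => [nE|_].
  by case/eqP: nm; apply: val_inj.
by rewrite mul0r mulr0.
Qed.

Hypothesis a1 : forall n, cabs (a n) <= 1.
Hypothesis h1 : rnorm h <= 1.

Let rnorm_trunc N : rnorm (trunc N) ^+ 2 <= \sum_(n < N) w n ^- 2.
Proof.
have -> : rnorm (trunc N) ^+ 2 =
    \sum_(n < N) cabs (a n) ^+ 2 * (w n ^- 2 * rnorm h ^+ n ^+ 2).
  apply: complexI; rewrite -hdotxx hdot_suml rmorph_sum; apply: eq_bigr => n _.
  rewrite hdot_sumr (bigD1 n) //= big1 ?addr0 => [|m mn].
    rewrite (hdotZl _ (eta n h)) (hdotZr _ _ (eta n h)) conjCK mulrA.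
    by rewrite mul_conj_cabs hdotxx rnorm_dual_pow // !rmorphM.
  rewrite (hdotZl _ (eta n h)) (hdotZr _ _ (eta m h)) hdot_dual_pow2 //.
  case: eqVneq => [nE|_]; last by rewrite mul0r !mulr0.
  by case/eqP: mn; apply: val_inj.
apply: ler_sum => n _.
have w0 : 0 <= w n ^- 2 by rewrite invr_ge0 exprn_ge0 // ltW.
rewrite -[leRHS]mul1r ler_pM ?sqr_ge0 ?mulr_ge0 ?exprn_ge0 ?rnorm_ge0 //.
  by rewrite exprn_ile1 ?cabs_ge0.
by rewrite -[leRHS]mulr1 ler_wpM2l // !exprn_ile1 ?exprn_ge0 ?rnorm_ge0.
Qed.

(** A finite combination of elementary tensors meets finitely many degrees, so on it the functional
    is the pairing with some [trunc N], of norm at most [M] whatever N is. No series is summed in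
    [F]. The weights [a] serve to describe tails of coherent vectors. *)
Lemma weighted_coherent_exists M : 0 <= M ->
  (forall N, \sum_(n < N) w n ^- 2 <= M ^+ 2) ->
  exists2 xi : F, rnorm xi <= M &
    forall n (x : 'I_n -> H), hdot xi (e x) = a n * \prod_i hdot h (x i).
Proof.
move=> M0 wM; pose I := {n : nat & 'I_n -> H}.
pose v (i : I) : F := e (projT2 i).
pose phi (i : I) := a (projT1 i) * \prod_j hdot h (projT2 i j).
have [s|//|xi xiM xiP] := @riesz_family R F I v phi M; last first.
  by exists xi => // n x; apply: (xiP (existT _ n x)).
have [N0 sN] : exists N0, forall N, (N0 <= N)%N ->
    lincomb (phi : I -> R[i]^o) s = hdot (trunc N) (lincomb v s).
  elim: s => [|[c [n x]] s [N0 IH]].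
    by exists 0%N => N _; rewrite /lincomb !big_nil hdot0r.
  exists (maxn N0 n.+1) => N; rewrite geq_max => /andP[/IH + nN].
  by rewrite /lincomb !big_cons hdotPr hdot_trunc // => ->.
rewrite (sN N0) //; apply: le_trans (hdot_cauchy_schwarz _ _) _.
rewrite ler_wpM2r ?rnorm_ge0 // -(ler_pXn2r (n := 2)) ?nnegrE ?rnorm_ge0 //.
exact: le_trans (rnorm_trunc _) (wM _).
Qed.

End Weighted.

Lemma coherent_exists h : rnorm h <= 1 -> exists xi, coherent h xi.
Proof.
move=> h1; have [M M0 wM] := l2_bound.
have [|xi _ xiP] := @weighted_coherent_exists (fun=> 1) h _ h1 M M0 wM.
  by move=> _; rewrite cabs1.
by exists xi => n x; rewrite xiP mul1r.
Qed.

(* The pairing of f with the coherent vector of [t *: h] is a power series in t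
   whose coefficients are the pairings of f with the powers of h. *)
Lemma coherent_total (f : F) :
  (forall h xi, rnorm h <= 1 -> coherent h xi -> hdot xi f = 0) -> f = 0.
Proof.
move=> f0; have [M M0 wM] := l2_bound.
have unit_ball n h : rnorm h <= 1 -> hdot (eta n h) f = 0.
  elim/ltn_ind: n => n IH h1.
  (* Once the coefficients below n vanish, dividing the power series by t^n leaves the n-th
     coefficient up to an error of order t. *)
  have small (t : R) : 0 < t -> t <= 1 -> cabs (hdot (eta n h) f) <= t * (M * rnorm f).
    move=> t0 t1.
    have th1 : rnorm (t%:C *: h) <= 1.
      by rewrite rnormZ cabs_ger0 ?(ltW t0) // mulr_ile1 ?rnorm_ge0 ?(ltW t0).
    have [xi xiP] := coherent_exists th1.
    (* [z] is the part of [xi] in degrees above n, divided by t^(n+1). Its weights stay at most 1,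
       so the bound [M] does not depend on t. *)
    have [|z zM zP] := @weighted_coherent_exists
      (fun m => if (n < m)%N then (t ^+ (m - n.+1))%:C else 0) h _ h1 M M0 wM.
      move=> m; case: ifP => _; last by rewrite cabs0 ler01.
      by rewrite cabs_ger0 ?exprn_ge0 ?exprn_ile1 ?(ltW t0).
    have xiE : xi = \sum_(k < n.+1) (t ^+ k)%:C *: eta k h + (t ^+ n.+1)%:C *: z.
      apply: (fock_tens_eq w_gt0) => m x.
      rewrite xiP hdotDl (hdotZl _ z) zP conj_real hdot_suml.
      have -> : \prod_i hdot (t%:C *: h) (x i) = (t ^+ m)%:C * \prod_i hdot h (x i).
        under eq_bigr do rewrite hdotZl conj_real.
        by rewrite big_split prodr_const card_ord /= rmorphXn.
      rewrite [X in _ = X + _](eq_bigr (fun k : 'I_n.+1 =>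
          (t ^+ k)%:C * (k == m :> nat)%:R * \prod_i hdot h (x i))); last first.
        by move=> k _; rewrite (hdotZl _ (eta k h)) conj_real hdot_dual_pow // mulrA.
      rewrite -mulr_suml mulrA -mulrDl; congr (_ * _).
      case: (ltnP n m) => [nm|mn].
        rewrite big1 ?add0r => [|k _]; first by rewrite -rmorphM -exprD subnKC.
        by rewrite ltn_eqF ?mulr0 // (leq_ltn_trans _ nm) // -ltnS.
      rewrite mulr0 addr0 (bigD1 (Ordinal (n := n.+1) (m := m) mn)) //= eqxx mulr1.
      rewrite big1 ?addr0 // => k kn; case: eqVneq => [km|_]; last by rewrite mulr0.
      by case/eqP: kn; apply: val_inj.
    have := f0 _ _ th1 xiP.
    rewrite xiE hdotDl hdot_suml big_ord_recr /= big1 => [|k _]; last first.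
      by rewrite (hdotZl _ (eta k h)) (IH _ (ltn_ord k)) ?mulr0.
    rewrite (hdotZl _ (eta n h)) (hdotZl _ z) !conj_real add0r.
    move: (hdot (eta n h) f) => A.
    have -> : (t ^+ n)%:C * A + (t ^+ n.+1)%:C * hdot z f =
        (t ^+ n)%:C * (A + t%:C * hdot z f) by rewrite exprS rmorphM /=; ring.
    move=> /eqP; rewrite mulf_eq0 (inj_eq (@complexI R)) expf_eq0 gt_eqF // andbF /=.
    rewrite addr_eq0 => /eqP ->; rewrite cabsN cabsM cabs_ger0 ?(ltW t0) //.
    rewrite ler_wpM2l ?(ltW t0) //; apply: le_trans (hdot_cauchy_schwarz _ _) _.
    by rewrite ler_wpM2r ?rnorm_ge0.
  apply: cabs0_eq0; apply/eqP; rewrite eq_le cabs_ge0 andbT.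
  apply/ler_addgt0Pr => d d0; rewrite add0r.
  have Mf : 0 <= M * rnorm f by rewrite mulr_ge0 ?rnorm_ge0.
  pose t := Num.min 1 (d / (M * rnorm f + 1)).
  have t0 : 0 < t by rewrite lt_min ltr01 divr_gt0 // ltr_wpDl.
  have t1 : t <= 1 by rewrite ge_min lexx.
  apply: le_trans (small t t0 t1) _.
  have : t <= d / (M * rnorm f + 1) by rewrite ge_min lexx orbT.
  rewrite ler_pdivlMr ?ltr_wpDl // mulrDr mulr1; apply: le_trans.
  by rewrite lerDl ltW.
apply: (dual_pow_total w_gt0) => n h.
have [h0|hn] := eqVneq (rnorm h) 0; first by apply: unit_ball; rewrite h0 ler01.
have -> : h = (rnorm h)%:C *: ((rnorm h)^-1%:C *: h).
  by rewrite scalerA -rmorphM divff // scale1r.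
rewrite dual_powZ // (hdotZl _ (eta n _)) unit_ball ?mulr0 //.
by rewrite rnormZ cabs_ger0 ?invr_ge0 ?rnorm_ge0 // mulVf.
Qed.

Lemma coherent_eq (f g : F) :
  (forall h xi, rnorm h <= 1 -> coherent h xi -> hdot xi f = hdot xi g) -> f = g.
Proof.
move=> fg; apply/eqP; rewrite -subr_eq0; apply/eqP/coherent_total => h xi h1 xih.
by rewrite hdotBr (fg h) // subrr.
Qed.

Lemma coherent_vee (vee : F -> F -> F) h xi : is_vee vee -> coherent h xi ->
  forall f g, hdot xi (vee f g) = hdot xi f * hdot xi g.
Proof.
move=> veeP xih f g.
rewrite (vee_form w_gt0 veeP (r := [:: tt]) (p := fun=> xi) (q := fun=> xi)).
  by rewrite big_seq1.
by move=> n m x y; rewrite big_seq1 !xih prod_ord_cat.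
Qed.

Section Algebra.
Variable vee : F -> F -> F.
Hypothesis veeP : is_vee vee.

Lemma coherent_unit h xi : coherent h xi -> hdot xi (fock_unit F) = 1.
Proof. by move=> xih; rewrite -[fock_unit F]/(e _) xih big_ord0. Qed.

(** Coherent vectors give multiplicative functionals that separate points, so the identity is
    inherited from the complex numbers; associativity and the unit law follow the same way. *)
Lemma veeC : commutative vee.
Proof.
move=> f g; apply: coherent_eq => h xi _ xih.
by rewrite !(coherent_vee veeP xih) mulrC.
Qed.

Lemma veeA : associative vee.
Proof.
move=> f g k; apply: coherent_eq => h xi _ xih.
by rewrite !(coherent_vee veeP xih) mulrA.
Qed.

Lemma vee1l : left_id (fock_unit F) vee.
Proof.
move=> f; apply: coherent_eq => h xi _ xih.
by rewrite (coherent_vee veeP xih) (coherent_unit xih) mul1r.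
Qed.

Lemma rnorm_fock_unit : w 0%N = 1 -> rnorm (fock_unit F) = 1.
Proof.
move=> w0; apply/eqP; rewrite -sqrp_eq1 ?rnorm_ge0 //; apply/eqP/complexI.
rewrite -hdotxx -[fock_unit F]/(e _) hdot_fock_tens w0 expr1n mul1r fact0.
by rewrite invr1 mul1r sumr_const card_Sn big_ord0.
Qed.

End Algebra.

End CoherentVectors.

(** * Comultiplication and the operator norm *)

Section Comultiplication.
Variables (R : realType) (H : hilbertType R) (P : forall n, htpower H n).
Variables (w : nat -> R) (F : fock_space P w).
Hypothesis w_gt0 : forall n, 0 < w n.
Variable C : R.
Hypothesis w_conv : forall n,
  \sum_(k < n.+1) (w k) ^- 2 * (w (n - k)%N) ^- 2 <= C * (w n) ^- 2.
Variable vee : F -> F -> F.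
Hypothesis veeP : is_vee vee.
Variable T : htensor F F.

Local Notation eta := (dual_pow F).

(** This makes f (x) g |-> f \/ g bounded on algebraic tensors. Pairing [z] with dual powers amounts
    to pairing [tau] with their coproduct; the Riesz vector [z'] of these pairings obeys the bound
    and equals [z] by totality. *)
Lemma rnorm_lincomb_vee (s : seq (R[i] * (F * F))) :
  rnorm (lincomb (fun fg => vee fg.1 fg.2) s) <=
  Num.sqrt C * rnorm (lincomb (fun fg => htens T fg.1 fg.2) s).
Proof.
set z := lincomb _ s; set tau := lincomb _ s.
have M0 : 0 <= Num.sqrt C * rnorm tau by rewrite mulr_ge0 ?sqrtr_ge0 ?rnorm_ge0.
pose eta2 (a : nat * H) : F := eta a.1 a.2.
have [r|//|z' z'M z'P] :=
    @riesz_family R F _ eta2 (fun a => hdot z (eta2 a)) (Num.sqrt C * rnorm tau).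
  pose d := lincomb (fun fg => htens T fg.1 fg.2) (coproduct F r).
  have -> : lincomb (fun a => hdot z (eta2 a) : R[i]^o) r = hdot z (lincomb eta2 r).
    by rewrite hdot_sumr; apply: eq_bigr => a _; rewrite [RHS]hdotZr.
  have -> : hdot z (lincomb eta2 r) = hdot tau d.
    rewrite hdotC [RHS]hdotC; congr (_^*).
    rewrite !hdot_suml big_coproduct; apply: eq_bigr => a _ /=.
    rewrite hdotZl !hdot_sumr mulr_sumr.
    under [RHS]eq_bigr do rewrite hdotZl hdot_sumr mulr_sumr.
    rewrite exchange_big; apply: eq_bigr => p _ /=.
    rewrite hdotZr (vee_dual_pow w_gt0 veeP) !mulr_sumr; apply: eq_bigr => k _.
    by rewrite hdotZr htens_dot.
  apply: le_trans (hdot_cauchy_schwarz _ _) _.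
  rewrite mulrC mulrAC ler_wpM2r ?rnorm_ge0 //.
  rewrite -(ler_pXn2r (n := 2)) ?nnegrE ?mulr_ge0 ?rnorm_ge0 ?sqrtr_ge0 //.
  rewrite exprMn sqr_sqrtr ?(conv_const_ge0 w_gt0 w_conv) //.
  apply: le_trans _ (coproduct_bound F w_gt0 w_conv r).
  rewrite (_ : tens_sqnorm _ _ _ _ = (rnorm d ^+ 2)%:C) //.
  rewrite -hdotxx hdot_suml; apply: eq_bigr => a _.
  rewrite hdot_sumr; apply: eq_bigr => b _.
  by rewrite hdotZl hdotZr htens_dot [RHS]mulrA.
suff -> : z = z' by [].
apply: (dual_pow_eq w_gt0) => n h.
by rewrite hdotC [RHS]hdotC; congr (_^*); rewrite (z'P (n, h)).
Qed.

Lemma htens_eq (a b : T) :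
  (forall f g, hdot a (htens T f g) = hdot b (htens T f g)) -> a = b.
Proof.
move=> ab; apply/eqP; rewrite -subr_eq0; apply/eqP.
apply: dense_span_orth_eq0 (htens_dense T) _ => _ [f [g ->]].
by rewrite hdotC hdotBl ab subrr rmorph0.
Qed.

(** The adjoint of the multiplication, built vector by vector. It sends the representing vector of a
    character to its tensor square precisely because the character is multiplicative. *)
Lemma comultiplication_exists : exists Delta : F -> T,
  [/\ linear Delta, bounded_map Delta &
      forall u f g, hdot (Delta u) (htens T f g) = hdot u (vee f g)].
Proof.
have /choice[Delta DeltaP] : forall u : F, exists d : T,
    rnorm d <= Num.sqrt C * rnorm u /\
    forall f g, hdot d (htens T f g) = hdot u (vee f g).
  move=> u; have M0 : 0 <= Num.sqrt C * rnorm u by rewrite mulr_ge0 ?sqrtr_ge0 ?rnorm_ge0.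
  have [s|//|d dM dP] := @riesz_family R T _ (fun fg => htens T fg.1 fg.2)
      (fun fg => hdot u (vee fg.1 fg.2)) (Num.sqrt C * rnorm u).
    have -> : lincomb (fun fg => hdot u (vee fg.1 fg.2) : R[i]^o) s =
        hdot u (lincomb (fun fg => vee fg.1 fg.2) s).
      by rewrite hdot_sumr; apply: eq_bigr => a _; rewrite hdotZr.
    apply: le_trans (hdot_cauchy_schwarz _ _) _.
    by rewrite mulrAC mulrC ler_wpM2r ?rnorm_ge0 ?rnorm_lincomb_vee.
  by exists d; split=> // f g; apply: (dP (f, g)).
exists Delta; split=> [a u v||u f g]; last exact: (DeltaP u).2.
  apply: htens_eq => f g; rewrite hdotDl hdotZl.
  by rewrite !(DeltaP _).2 hdotDl hdotZl.
exists (Num.sqrt C)%:C => u.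
by rewrite !normE -rmorphM lecR; apply: (DeltaP u).1.
Qed.

End Comultiplication.

(** * Operator norm and automatic continuity of characters *)

Section OperatorNorm.
Variables (R : realType) (V : completeNormedModType R[i]) (mul : V -> V -> V).
Hypothesis mul_bilin : bilinear_map mul.
Hypothesis mulA : associative mul.
Variable u : V.
Hypothesis mulu : right_id u mul.
Hypothesis u1 : rnorm u = 1.
Variable K : R.
Hypothesis K0 : 0 <= K.
Hypothesis mulK : forall f g, rnorm (mul f g) <= K * rnorm f * rnorm g.

Local Notation N := (op_norm mul).

Lemma mul_linl a f g h : mul (a *: f + g) h = a *: mul f h + mul g h.
Proof. by case: mul_bilin => ml _; apply: ml. Qed.

Lemma mul_linr a f g h : mul h (a *: f + g) = a *: mul h f + mul h g.
Proof. by case: mul_bilin => _ mr; apply: mr. Qed.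

Lemma mul0_r f : mul f 0 = 0.
Proof. by have := mul_linr (-1) 0 0 f; rewrite scaler0 addr0 scaleN1r addNr. Qed.

Lemma mul_scaler a f g : mul f (a *: g) = a *: mul f g.
Proof. by rewrite -[a *: g]addr0 mul_linr mul0_r addr0. Qed.

Lemma mulBr f g h : mul f (g - h) = mul f g - mul f h.
Proof. by rewrite addrC -scaleN1r mul_linr scaleN1r addrC. Qed.

Lemma op_norm_le f (B : R) : 0 <= B ->
  (forall g, rnorm (mul f g) <= B * rnorm g) -> N f <= B.
Proof.
move=> B0 fB; apply: ge_sup.
  by exists (rnorm (mul f 0)), 0 => //=; rewrite normr0 ler01.
move=> _ [g /= g1 <-]; apply: le_trans (fB g) _.
by rewrite -[leRHS]mulr1 ler_wpM2l // -lecR -normE.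
Qed.

Lemma op_norm_has_sup f :
  has_sup [set complex.Re `|mul f g| | g in [set g | `|g| <= 1]].
Proof.
split; first by exists (rnorm (mul f 0)), 0 => //=; rewrite normr0 ler01.
exists (K * rnorm f) => _ [g /= g1 <-]; apply: le_trans (mulK f g) _.
by rewrite -[leRHS]mulr1 ler_wpM2l ?mulr_ge0 ?rnorm_ge0 // -lecR -normE.
Qed.

Lemma rnorm_mul_op_norm f g : rnorm (mul f g) <= N f * rnorm g.
Proof.
have [g0|gn] := eqVneq (rnorm g) 0.
  by rewrite (rnorm0_eq0 g0) mul0_r rnorm0 mulr0.
have gp : 0 < rnorm g by rewrite lt_neqAle eq_sym gn rnorm_ge0.
rewrite -ler_pdivrMr //.
have -> : rnorm (mul f g) / rnorm g = rnorm (mul f ((rnorm g)^-1%:C *: g)).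
  by rewrite mul_scaler rnormZ cabs_ger0 ?invr_ge0 ?ltW // mulrC.
apply: sup_upper_bound; first exact: op_norm_has_sup.
exists ((rnorm g)^-1%:C *: g) => //=.
by rewrite normE rnormZ cabs_ger0 ?invr_ge0 ?rnorm_ge0 // mulVf ?lexx.
Qed.

Lemma op_norm_ge0 f : 0 <= N f.
Proof.
by rewrite -[N f]mulr1 -u1; apply: le_trans (rnorm_mul_op_norm f u); apply: rnorm_ge0.
Qed.

Lemma rnorm_le_op_norm f : rnorm f <= N f.
Proof. by rewrite -{1}(mulu f) -[N f]mulr1 -u1 rnorm_mul_op_norm. Qed.

Lemma op_norm_le_rnorm f : N f <= K * rnorm f.
Proof. by apply: op_norm_le => [|g]; rewrite ?mulr_ge0 ?rnorm_ge0 ?mulK. Qed.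

(** Applying the operator to the unit vector [u] gives |f| <= N f, and [mulK] gives N f <= K |f|.
    The norms are equivalent, so completeness transfers. *)
Lemma op_norm_banach : banach_algebra mul N.
Proof.
split=> //.
- move=> f f0; apply: rnorm0_eq0; apply/eqP.
  by rewrite eq_le rnorm_ge0 andbT -f0 rnorm_le_op_norm.
- move=> f g; apply: op_norm_le => [|h]; first by rewrite addr_ge0 ?op_norm_ge0.
  rewrite -(scale1r f) mul_linl !scale1r mulrDl.
  by apply: le_trans (rnormD _ _) (lerD _ _); apply: rnorm_mul_op_norm.
(* Only one inequality needs an argument; the other is the same one for the inverse scalar. *)
- have Nle a f : N (a *: f) <= cabs a * N f.
    apply: op_norm_le => [|h]; first by rewrite mulr_ge0 ?cabs_ge0 ?op_norm_ge0.
    have -> : mul (a *: f) h = a *: mul f h.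
      have m0 : mul 0 h = 0.
        by have := mul_linl (-1) 0 0 h; rewrite scaler0 addr0 scaleN1r addNr.
      by rewrite -[a *: f]addr0 mul_linl m0 addr0.
    by rewrite rnormZ -mulrA ler_wpM2l ?cabs_ge0 ?rnorm_mul_op_norm.
  move=> a f; rewrite cabsE -rmorphM; congr (_%:C); apply/eqP.
  rewrite eq_le Nle /=; have [->|a0] := eqVneq a 0.
    by rewrite cabs0 mul0r op_norm_ge0.
  have ca : 0 < cabs a.
    by rewrite lt_neqAle cabs_ge0 andbT eq_sym; apply: contra_neq a0 => /cabs0_eq0.
  rewrite -ler_pdivlMl // -cabsV; apply: le_trans (Nle _ _).
  by rewrite scalerA mulVf // scale1r.
- move=> f g; apply: op_norm_le => [|h]; first by rewrite mulr_ge0 ?op_norm_ge0.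
  rewrite -mulA; apply: le_trans (rnorm_mul_op_norm _ _) _.
  by rewrite -mulrA ler_wpM2l ?op_norm_ge0 ?rnorm_mul_op_norm.
move=> v cv; have [e e0|l lP] := rnorm_complete (u := v).
  have [n0 n0P] := cv e e0; exists n0 => m n mm nn.
  exact: le_lt_trans (rnorm_le_op_norm _) (n0P m n mm nn).
exists l => e e0; have [|n0 n0P] := lP (e / (K + 1)).
  by rewrite divr_gt0 // ltr_wpDl.
exists n0 => n nn; apply: le_lt_trans (op_norm_le_rnorm _) _.
have := n0P n nn; rewrite ltr_pdivlMr ?ltr_wpDl // mulrDr mulr1 mulrC.
by have := rnorm_ge0 (v n - l); lra.
Qed.

(* If chi f = 1 and N f < 1 then u - f is invertible (geometric series), yet it
   is killed by chi. *)
Lemma character_le_op_norm chi f : is_character mul chi -> cabs (chi f) <= N f.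
Proof.
case=> chil chim [g0 g0P].
have chi0 : chi 0 = 0.
  by have := chil (-1) 0 0; rewrite scaler0 addr0 mulN1r addNr.
have chiZ a g : chi (a *: g) = a * chi g.
  by rewrite -[a *: g]addr0 chil chi0 addr0.
rewrite leNgt; apply/negP => Nf.
have cf : 0 < cabs (chi f) by apply: le_lt_trans (op_norm_ge0 f) Nf.
have cn : chi f != 0 by apply: contraTneq cf => ->; rewrite cabs0 ltxx.
pose r := N f / cabs (chi f).
have r0 : 0 <= r by rewrite divr_ge0 ?cabs_ge0 ?op_norm_ge0.
have r1 : r < 1 by rewrite ltr_pdivrMr // mul1r.
(* Multiplication by f / chi f: a contraction of ratio [r] in the Hilbert space norm that leaves
   [chi] unchanged. The iterates [v n] below are the partial sums of the Neumann series applied to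
   [u]. *)
pose L g := (chi f)^-1 *: mul f g.
have LB g h : L g - L h = L (g - h) by rewrite /L mulBr scalerBr.
have Lr g : rnorm (L g) <= r * rnorm g.
  rewrite /L rnormZ cabsV /r mulrC mulrAC ler_pM2r ?invr_gt0 //.
  exact: rnorm_mul_op_norm.
have chiL g : chi (L g) = chi g.
  by rewrite chiZ chim mulrA mulVf // mul1r.
pose v n := iter n (fun g => u + L g) 0.
have vS n : v n.+1 = u + L (v n) by [].
pose B := (1 - r)^-1.
have B0 : 0 <= B by rewrite invr_ge0 subr_ge0 ltW.
have vB k : rnorm (v k) <= B.
  elim: k => [|k IH]; first by rewrite rnorm0.
  rewrite vS; apply: le_trans (rnormD _ _) _; rewrite u1.
  apply: le_trans (_ : 1 + r * B <= _); last first.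
    have : (1 - r) * B = 1 by rewrite mulfV // subr_eq0 gt_eqF.
    by lra.
  by rewrite lerD2l; apply: le_trans (Lr _) _; rewrite ler_wpM2l.
have vr n k : rnorm (v (n + k)%N - v n) <= r ^+ n * B.
  elim: n => [|n IH]; first by rewrite subr0 mul1r.
  rewrite addSn !vS opprD addrACA subrr add0r LB exprS -mulrA.
  by apply: le_trans (Lr _) _; rewrite ler_wpM2l.
have rn (e : R) : 0 < e -> exists n0, forall n, (n0 <= n)%N -> r ^+ n * B < e.
  move=> e0; have /cvgrPdist_lt/(_ (e / (B + 1))) : (r ^+ n @[n --> \oo] --> (0 : R)).
    by apply: cvg_expr; rewrite ger0_norm.
  have eB : 0 < e / (B + 1) by rewrite divr_gt0 // ltr_wpDl.
  move=> /(_ eB)[n0 _ n0P]; exists n0 => n nn.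
  have := n0P n nn; rewrite /= sub0r normrN ger0_norm ?exprn_ge0 //.
  rewrite ltr_pdivlMr ?ltr_wpDl // mulrDr mulr1.
  by have := exprn_ge0 n r0; lra.
have [e e0|l lP] := rnorm_complete (u := v).
  have [|n0 n0P] := rn (e / 2%:R); first by rewrite divr_gt0 ?ltr0n.
  exists n0 => m n mm nn.
  apply: le_lt_trans (rnorm_triangle _ (v n0) _) _.
  rewrite [e in _ < e]splitr ltrD //.
    by rewrite -(subnKC mm); apply: le_lt_trans (vr _ _) (n0P _ _).
  by rewrite rnorm_distC -(subnKC nn); apply: le_lt_trans (vr _ _) (n0P _ _).
have lE : l = u + L l.
  apply/eqP; rewrite -subr_eq0; apply/eqP/rnorm0_eq0/eqP.
  rewrite eq_le rnorm_ge0 andbT; apply/ler_addgt0Pr => e e0; rewrite add0r.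
  have [|n0 n0P] := lP (e / 2%:R); first by rewrite divr_gt0 ?ltr0n.
  apply: le_trans (rnorm_triangle _ (v n0.+1) _) _.
  rewrite [e]splitr lerD //.
    by rewrite rnorm_distC ltW // n0P.
  rewrite vS opprD addrACA subrr add0r LB; apply: le_trans (Lr _) _.
  have := n0P n0 (leqnn _); have := rnorm_ge0 (v n0 - l); by nra.
(* Applying [chi] to the fixed-point equation cancels [chi l]. The limit was taken before [chi]
   enters, so continuity of [chi] is not presupposed. *)
have chiu : chi u = 0.
  have : chi l = chi u + chi l.
    by rewrite {1}lE -[u in u + _]scale1r chil mul1r chiL.
  by move=> /(canLR (addrK _)); rewrite subrr => <-.
by case/eqP: g0P; rewrite -(mulu g0) chim chiu mulr0.
Qed.

End OperatorNorm.

(** * The Gelfand map *)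

Section Gelfand.
Variables (R : realType) (V : lmodType R[i]) (mul : V -> V -> V).

Lemma gelfand_continuous (f : V) :
  continuous (gelfand f : spectrum mul -> R[i]^o).
Proof.
move=> chi.
apply: (@continuous_comp _ _ _ (@char_val R V mul : spectrum mul -> {ptws V -> R[i]^o})
  (fun h : {ptws V -> R[i]^o} => h f)); first exact: initial_continuous.
exact: (@proj_continuous V (fun=> R[i]^o) f).
Qed.

Lemma char_valP (chi : spectrum mul) : is_character mul (char_val chi).
Proof. exact: (svalP (chi : {chi : V -> R[i] | is_character mul chi})). Qed.

Lemma gelfand_linear (a : R[i]) (f g : V) (chi : spectrum mul) :
  gelfand (a *: f + g) chi = a * gelfand f chi + gelfand g chi.
Proof. by have [cl _ _] := char_valP chi; apply: cl. Qed.

Lemma gelfand_mul (f g : V) (chi : spectrum mul) :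
  gelfand (mul f g) chi = gelfand f chi * gelfand g chi.
Proof. by have [_ cm _] := char_valP chi; apply: cm. Qed.

End Gelfand.
Theorem corollary10 (R : realType) (H : hilbertType R)
    (H_separable : separable_space H)
    (w : nat -> R) (w_gt0 : forall n, 0 < w n) (w0 : w 0%N = 1)
    (w_l2 : cvgn (series (fun n => (w n)^-1 ^+ 2)))
    (w_conv : exists C : R, forall n,
       \sum_(k < n.+1) (w k) ^- 2 * (w (n - k)%N) ^- 2 <= C * (w n) ^- 2)
    (P : forall n, htpower H n) (F : fock_space P w) :
  (exists! vee : F -> F -> F, is_vee vee) /\
  forall vee : F -> F -> F, is_vee vee ->
  let sigma := spectrum vee in
  [/\ banach_algebra vee (op_norm vee),
      commutative vee & left_id (fock_unit F) vee] /\
  (forall f : F, continuous (gelfand f : sigma -> R[i]^o)) /\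
  injective (fun f : F => gelfand f : sigma -> R[i]^o) /\
  exists Fhat : hfunspace R sigma,
    [/\ range (@hfun _ _ Fhat) = range (fun f : F => gelfand f : sigma -> R[i]),
        forall (f g : F) (fhat ghat : Fhat),
          hfun fhat = gelfand f -> hfun ghat = gelfand g ->
          hdot fhat ghat = hdot f g,
        is_rkha Fhat /\ hfun_unital Fhat,
        (forall chi : sigma,
           exists! xi : F, forall f, char_val chi f = hdot xi f) /\
        (exists2 khat : sigma -> sigma -> R[i],
           is_reproducing_kernel Fhat khat &
           forall (chi1 chi2 : sigma) (xi1 xi2 : F),
             (forall f, char_val chi1 f = hdot xi1 f) ->
             (forall f, char_val chi2 f = hdot xi2 f) ->
             khat chi1 chi2 = hdot xi1 xi2) &
        exists (mulhat : Fhat -> Fhat -> Fhat) (Gam : F -> Fhat),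
          [/\ is_pointwise_mul mulhat,
              banach_algebra mulhat (op_norm mulhat),
              forall f, hfun (Gam f) = gelfand f &
              banach_algebra_iso vee (op_norm vee) mulhat (op_norm mulhat) Gam]].
Proof.
have [C w_convC] := w_conv.
have [vee0 vee0P] := is_vee_exists F w_gt0 w_convC.
split.
  by exists vee0; split=> // vee veeP; exact: (is_vee_unique w_gt0 vee0P veeP).
move=> vee veeP sigma.
have [vee_lin /bounded_map2_real[K K0 veeK] _] := veeP.
have veeA' := veeA w_gt0 w_l2 veeP.
have veeC' := veeC w_gt0 w_l2 veeP.
have vee1' := vee1l w_gt0 w_l2 veeP.
have vee1r : right_id (fock_unit F) vee by move=> f; rewrite veeC'.
have u1 := rnorm_fock_unit F w0.
have vee_banach := op_norm_banach vee_lin veeA' vee1r u1 K0 veeK.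
have coherent_char h xi : coherent h xi -> is_character vee (hdot xi).
  move=> xih; split=> [a f g|f g|]; first exact: hdotPr.
    exact: (coherent_vee w_gt0 veeP xih).
  by exists (fock_unit F); rewrite (coherent_unit xih) oner_eq0.
have gel_inj : injective (fun f : F => gelfand f : sigma -> R[i]^o).
  move=> f g fg; apply: (coherent_eq w_gt0 w_l2) => h xi h1 xih.
  pose chi : sigma := exist _ _ (coherent_char _ _ xih).
  exact: (congr1 (fun k => k chi) fg).
have char_riesz (chi : sigma) : exists xi : F, forall f, char_val chi f = hdot xi f.
  have chiP := char_valP chi.
  have [|f|xi _ xiP] := riesz K0 _ (phi := char_val chi); last by exists xi.
    by case: chiP.
  apply: le_trans (character_le_op_norm vee_lin vee1r u1 K0 veeK f chiP) _.
  exact: op_norm_le_rnorm.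
have hdot_inj (xi xi' : F) : (forall f, hdot xi f = hdot xi' f) -> xi = xi'.
  by move=> xx; apply: (fock_tens_eq w_gt0) => n x; apply: xx.
split; first by split.
split; first exact: gelfand_continuous.
split=> //.
have [k kP] := choice char_riesz.
(* The Hilbert space is [F] itself, read as functions through [gelfand]; injectivity is what makes
   this a function space. The Gelfand map then becomes [id] and the pointwise product becomes
   [vee]. *)
pose Fhat : hfunspace R sigma :=
  @HFunSpace R sigma F (fun f chi => gelfand f chi) (@gelfand_linear _ _ vee) gel_inj.
exists Fhat; split.
- by [].
- by move=> f g fhat ghat /gel_inj-> /gel_inj->.
- split; last first.
    exists (fock_unit F) => chi; rewrite /= /gelfand.
    have [_ chim [g0 g0P]] := char_valP chi.
    by apply: (mulIf g0P); rewrite -chim vee1' mul1r.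
  exists k; split; first by move=> chi f; apply: kP.
  move=> T.
  have [Delta [Dlin Dbnd DeltaP]] := comultiplication_exists w_gt0 w_convC veeP T.
  exists Delta; split=> // chi.
  apply: htens_eq => f g; rewrite DeltaP htens_dot -!kP.
  exact: (gelfand_mul f g chi).
- split.
    move=> chi; have [xi xiP] := char_riesz chi; exists xi; split=> // xi' xi'P.
    by apply: hdot_inj => f; rewrite -xiP -xi'P.
  exists (fun chi1 chi2 => hdot (k chi1) (k chi2)).
    by exists k; split=> // chi f; apply: kP.
  move=> chi1 chi2 xi1 xi2 xi1P xi2P.
  by congr hdot; apply: hdot_inj => f; rewrite -kP.
- exists vee, id; split=> //; first by move=> f g chi; apply: gelfand_mul.
  split=> //; first by exists id.
    by exists 1 => f; rewrite mul1r.
  by exists 1 => f; rewrite mul1r.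
Qed.
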